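(* Let $k$ be a field of characteristic $0$ and let $\Theta$ be the variety of all Jordan algebras over $k$. Let $\mathfrak{A}$ be the group of all automorphisms of the category $\Theta^0$ of finitely generated free algebras of $\Theta$, and let $\mathfrak{Y}$ be the normal subgroup of all inner automorphisms. Then $$\mathfrak{A}/\mathfrak{Y}\;\cong\; \mathrm{Aut}\,k ,$$ where $\mathrm{Aut}\,k$ is the group of all field automorphisms of $k$.
   Context: A linear algebra over $k$ is a $k$-vector space with a $k$-bilinear multiplication (not assumed associative, commutative or unital). It is regarded as a one-sorted universal algebra with operations $0$, $+$, $\cdot$, and one unary operation $h\mapsto\lambda h$ for each $\lambda\in k$; homomorphisms are $k$-linear multiplicative maps. A linear algebra is a Jordan algebra if it satisfies $x_1x_2=x_2x_1$ and $((x_1x_1)x_2)x_1=(x_1x_1)(x_2x_1)$. Fix a countable set $X_0=\{x_1,x_2,\ldots\}$. The category $\Theta^0$ has as objects the free algebras $F(X)$ of $\Theta$ generated by finite subsets $X\subset X_0$, and as morphisms all homomorphisms between them. An automorphism of a category $\mathfrak{K}$ is an invertible functor $\mathfrak{K}\to\mathfrak{K}$; an automorphism $\Upsilon$ is inner if it is isomorphic as a functor to the identity functor, i.e. for each object $A$ there is an isomorphism $s_A:A\to\Upsilon(A)$ with $\Upsilon(\psi)s_A=s_B\psi$ for every morphism $\psi:A\to B$. *)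

(* Defs.v *)
From HB Require Import structures.
From mathcomp Require Import all_boot all_order all_algebra.
From mathcomp Require Import finmap.
From mathcomp Require Import boolp.

Set Implicit Arguments.
Unset Strict Implicit.
Unset Printing Implicit Defensive.

Import GRing.Theory.
Local Open Scope ring_scope.

(* Linear algebras over a field. The product [(x * y)%g] is the one of MathComp's
   [magmaType]: no associativity, commutativity or unit is assumed. *)

HB.mixin Record isLinearAlgebra (k : fieldType) V
    of GRing.Lmodule k V & Magma V := {
  la_mulDl : forall x y z : V, ((x + y)%R * z)%g = (x * z)%g + (y * z)%g;
  la_mulDr : forall x y z : V, (x * (y + z)%R)%g = (x * y)%g + (x * z)%g;
  la_scaleAl : forall (a : k) (x y : V), ((a *: x)%R * y)%g = a *: (x * y)%g;
  la_scaleAr : forall (a : k) (x y : V), (x * (a *: y)%R)%g = a *: (x * y)%g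
}.

#[short(type="linAlgType")]
HB.structure Definition LinearAlgebra (k : fieldType) :=
  {V of isLinearAlgebra k V & GRing.Lmodule k V & ChoiceMagma V}.

HB.mixin Record isJordan (k : fieldType) V of LinearAlgebra k V := {
  jordan_mulC : forall x y : V, (x * y = y * x)%g;
  jordan_identity : forall x y : V, (((x * x) * y) * x = (x * x) * (y * x))%g
}.

#[short(type="jordanAlgType")]
HB.structure Definition JordanAlgebra (k : fieldType) :=
  {V of isJordan k V & LinearAlgebra k V}.

Record algHom (k : fieldType) (A B : linAlgType k) := AlgHom {
  algHom_fun :> A -> B;
  algHom_linear : linear algHom_fun;
  algHom_mul : {morph algHom_fun : x y / (x * y)%g >-> (x * y)%g}
}.

Lemma algHom_eq (k : fieldType) (A B : linAlgType k) (f g : algHom A B) :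
  f =1 g -> f = g.
Proof.
case: f g => [f fl fm] [g gl gm] /= /funext e.
by subst g; congr AlgHom; apply: Prop_irrelevance.
Qed.

Section AlgHomComp.
Variable k : fieldType.

Lemma algHom_id_linear (A : linAlgType k) : linear (@id A).
Proof. by []. Qed.

Definition algHom_id (A : linAlgType k) : algHom A A :=
  AlgHom (@algHom_id_linear A) (fun _ _ => erefl).

Variables (A B C : linAlgType k) (g : algHom B C) (f : algHom A B).

Lemma algHom_comp_linear : linear (g \o f).
Proof. by move=> a x y /=; rewrite !algHom_linear. Qed.

Lemma algHom_comp_mul : {morph g \o f : x y / (x * y)%g >-> (x * y)%g}.
Proof. by move=> x y /=; rewrite !algHom_mul. Qed.

Definition algHom_comp : algHom A C := AlgHom algHom_comp_linear algHom_comp_mul.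

End AlgHomComp.

Lemma algHom_compA (k : fieldType) (A B C D : linAlgType k)
    (h : algHom C D) (g : algHom B C) (f : algHom A B) :
  algHom_comp h (algHom_comp g f) = algHom_comp (algHom_comp h g) f.
Proof. exact: algHom_eq. Qed.

Lemma algHom_comp1f (k : fieldType) (A B : linAlgType k) (f : algHom A B) :
  algHom_comp (algHom_id B) f = f.
Proof. exact: algHom_eq. Qed.

Lemma algHom_compf1 (k : fieldType) (A B : linAlgType k) (f : algHom A B) :
  algHom_comp f (algHom_id A) = f.
Proof. exact: algHom_eq. Qed.

(* The free Jordan algebra on X: terms in the signature 0, +, *, (scalar), modulo
   the identities that hold in every Jordan algebra over k. *)

Inductive algTerm (k : fieldType) (X : Type) : Type :=
  | Var of X
  | Zero
  | Add of algTerm k X & algTerm k X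
  | Mul of algTerm k X & algTerm k X
  | Scale of k & algTerm k X.
Arguments Var {k X}.
Arguments Zero {k X}.

HB.instance Definition _ (k : fieldType) (X : Type) := gen_eqMixin (algTerm k X).
HB.instance Definition _ (k : fieldType) (X : Type) := gen_choiceMixin (algTerm k X).

Fixpoint eval (k : fieldType) (X : Type) (A : linAlgType k) (v : X -> A)
    (t : algTerm k X) : A :=
  match t with
  | Var x => v x
  | Zero => 0
  | Add t u => eval v t + eval v u
  | Mul t u => (eval v t * eval v u)%g
  | Scale a t => a *: eval v t
  end.

Section FreeJordan.
Variables (k : fieldType) (X : Type).

Definition jordan_equiv (t u : algTerm k X) : Prop :=
  forall (J : jordanAlgType k) (v : X -> J), eval v t = eval v u.

Definition jordan_equivb (t u : algTerm k X) : bool := `[< jordan_equiv t u >].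

Lemma jordan_equiv_class_of : equiv_class_of jordan_equivb.
Proof.
split=> [t|t u|u t w].
- by apply/asboolP.
- by apply/asboolP/asboolP => H J v; rewrite H.
- by move=> /asboolP H1 /asboolP H2; apply/asboolP => J v; rewrite H1.
Qed.

Canonical jordan_equiv_rel := EquivRelPack jordan_equiv_class_of.

Definition freeJordan : Type := {eq_quot jordan_equiv_rel}%qT.
HB.instance Definition _ := Choice.on freeJordan.

Definition fj_class (t : algTerm k X) : freeJordan :=
  (\pi_{eq_quot jordan_equiv_rel} t)%qT.
Definition fj_repr (x : freeJordan) : algTerm k X :=
  repr (x : {eq_quot jordan_equiv_rel}%qT).

Lemma fj_reprK x : fj_class (fj_repr x) = x.
Proof. exact: reprK. Qed.

Lemma fj_classP t u : fj_class t = fj_class u <-> jordan_equiv t u.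
Proof.
rewrite /fj_class; split=> [/eqquotP /asboolP //|H].
by apply/eqquotP/asboolP.
Qed.

Definition fj_var (x : X) : freeJordan := fj_class (Var x).

Definition fj_eval (J : jordanAlgType k) (v : X -> J) (x : freeJordan) : J :=
  eval v (fj_repr x).

Lemma fj_eval_class (J : jordanAlgType k) (v : X -> J) t :
  fj_eval v (fj_class t) = eval v t.
Proof. by move: J v; apply/fj_classP; rewrite fj_reprK. Qed.

Lemma fj_eval_inj x y :
  (forall (J : jordanAlgType k) (v : X -> J), fj_eval v x = fj_eval v y) -> x = y.
Proof. by move=> H; rewrite -(fj_reprK x) -(fj_reprK y); apply/fj_classP. Qed.

Definition fj_zero : freeJordan := fj_class Zero.
Definition fj_add (x y : freeJordan) := fj_class (Add (fj_repr x) (fj_repr y)).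
Definition fj_mul (x y : freeJordan) := fj_class (Mul (fj_repr x) (fj_repr y)).
Definition fj_scale (a : k) (x : freeJordan) := fj_class (Scale a (fj_repr x)).
Definition fj_opp (x : freeJordan) := fj_scale (-1) x.

Section Eval.
Variables (J : jordanAlgType k) (v : X -> J).

Lemma fj_eval0 : fj_eval v fj_zero = 0.
Proof. by rewrite fj_eval_class. Qed.

Lemma fj_evalD x y : fj_eval v (fj_add x y) = fj_eval v x + fj_eval v y.
Proof. by rewrite fj_eval_class. Qed.

Lemma fj_evalM x y : fj_eval v (fj_mul x y) = (fj_eval v x * fj_eval v y)%g.
Proof. by rewrite fj_eval_class. Qed.

Lemma fj_evalZ a x : fj_eval v (fj_scale a x) = a *: fj_eval v x.
Proof. by rewrite fj_eval_class. Qed.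

Lemma fj_evalN x : fj_eval v (fj_opp x) = - fj_eval v x.
Proof. by rewrite fj_evalZ scaleN1r. Qed.

Definition fj_evalE := (fj_eval0, fj_evalD, fj_evalM, fj_evalN, fj_evalZ).
End Eval.

Lemma fj_addA : associative fj_add.
Proof. by move=> x y z; apply: fj_eval_inj => J v; rewrite !fj_evalE addrA. Qed.

Lemma fj_addC : commutative fj_add.
Proof. by move=> x y; apply: fj_eval_inj => J v; rewrite !fj_evalE addrC. Qed.

Lemma fj_add0 : left_id fj_zero fj_add.
Proof. by move=> x; apply: fj_eval_inj => J v; rewrite !fj_evalE add0r. Qed.

Lemma fj_addN : left_inverse fj_zero fj_opp fj_add.
Proof. by move=> x; apply: fj_eval_inj => J v; rewrite !fj_evalE addNr. Qed.

HB.instance Definition _ :=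
  GRing.isZmodule.Build freeJordan fj_addA fj_addC fj_add0 fj_addN.

Lemma fj_scaleA a b x : fj_scale a (fj_scale b x) = fj_scale (a * b) x.
Proof. by apply: fj_eval_inj => J v; rewrite !fj_evalE scalerA. Qed.

Lemma fj_scale1 : left_id 1 fj_scale.
Proof. by move=> x; apply: fj_eval_inj => J v; rewrite !fj_evalE scale1r. Qed.

Lemma fj_scaleDr : right_distributive fj_scale +%R.
Proof. by move=> a x y; apply: fj_eval_inj => J v; rewrite !fj_evalE scalerDr. Qed.

Lemma fj_scaleDl x : {morph fj_scale^~ x : a b / a + b}.
Proof. by move=> a b; apply: fj_eval_inj => J v; rewrite !fj_evalE scalerDl. Qed.

HB.instance Definition _ := GRing.Zmodule_isLmodule.Build k freeJordan
  fj_scaleA fj_scale1 fj_scaleDr fj_scaleDl.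

HB.instance Definition _ := hasMul.Build freeJordan fj_mul.

Lemma fj_mulDl (x y z : freeJordan) :
  ((x + y)%R * z)%g = (x * z)%g + (y * z)%g.
Proof. by apply: fj_eval_inj => J v; rewrite !fj_evalE la_mulDl. Qed.

Lemma fj_mulDr (x y z : freeJordan) :
  (x * (y + z)%R)%g = (x * y)%g + (x * z)%g.
Proof. by apply: fj_eval_inj => J v; rewrite !fj_evalE la_mulDr. Qed.

Lemma fj_scaleAl (a : k) (x y : freeJordan) :
  ((a *: x)%R * y)%g = a *: (x * y)%g.
Proof. by apply: fj_eval_inj => J v; rewrite !fj_evalE la_scaleAl. Qed.

Lemma fj_scaleAr (a : k) (x y : freeJordan) :
  (x * (a *: y)%R)%g = a *: (x * y)%g.
Proof. by apply: fj_eval_inj => J v; rewrite !fj_evalE la_scaleAr. Qed.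

HB.instance Definition _ := isLinearAlgebra.Build k freeJordan
  fj_mulDl fj_mulDr fj_scaleAl fj_scaleAr.

Lemma fj_mulC (x y : freeJordan) : (x * y = y * x)%g.
Proof. by apply: fj_eval_inj => J v; rewrite !fj_evalE jordan_mulC. Qed.

Lemma fj_identity (x y : freeJordan) :
  (((x * x) * y) * x = (x * x) * (y * x))%g.
Proof. by apply: fj_eval_inj => J v; rewrite !fj_evalE jordan_identity. Qed.

HB.instance Definition _ := isJordan.Build k freeJordan fj_mulC fj_identity.

Lemma fj_eval_linear (J : jordanAlgType k) (v : X -> J) : linear (fj_eval v).
Proof. by move=> a x y; rewrite !fj_evalE. Qed.

Definition fj_lift (J : jordanAlgType k) (v : X -> J) :
    algHom (freeJordan : linAlgType k) J :=
  AlgHom (fj_eval_linear v) (fj_evalM v).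

Lemma fj_lift_var (J : jordanAlgType k) (v : X -> J) x : fj_lift v (fj_var x) = v x.
Proof. by rewrite /= fj_eval_class. Qed.

Lemma fj_lift_unique (J : jordanAlgType k) (v : X -> J)
    (f : algHom (freeJordan : linAlgType k) J) :
  (forall x, f (fj_var x) = v x) -> f = fj_lift v.
Proof.
move=> fv; apply: algHom_eq => x; rewrite -(fj_reprK x) /= fj_eval_class.
have f0 : f 0 = 0.
  by have := algHom_linear f (-1) 0 0; rewrite scaler0 addr0 scaleN1r addNr.
have mk_add t u : fj_class (Add t u) = fj_class t + fj_class u.
  by apply: fj_eval_inj => K w; rewrite fj_evalE !fj_eval_class.
have mk_mul t u : fj_class (Mul t u) = (fj_class t * fj_class u)%g.
  by apply: fj_eval_inj => K w; rewrite fj_evalE !fj_eval_class.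
have mk_scale a t : fj_class (Scale a t) = a *: fj_class t.
  by apply: fj_eval_inj => K w; rewrite fj_evalE !fj_eval_class.
elim: (fj_repr x) => {x} [x||t IHt u IHu|t IHt u IHu|a t IHt] /=.
- exact: fv.
- exact: f0.
- rewrite mk_add -IHt -IHu -{1}[fj_class t]scale1r algHom_linear.
  by rewrite scale1r.
- by rewrite mk_mul algHom_mul IHt IHu.
- by rewrite mk_scale -[a *: _]addr0 algHom_linear f0 addr0 IHt.
Qed.

End FreeJordan.

Record category := Category {
  cat_obj :> Type;
  cat_hom : cat_obj -> cat_obj -> Type;
  cat_id : forall A, cat_hom A A;
  cat_comp : forall A B C, cat_hom B C -> cat_hom A B -> cat_hom A C;
  cat_compA : forall A B C D
      (h : cat_hom C D) (g : cat_hom B C) (f : cat_hom A B),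
    cat_comp h (cat_comp g f) = cat_comp (cat_comp h g) f;
  cat_comp1f : forall A B (f : cat_hom A B), cat_comp (cat_id B) f = f;
  cat_compf1 : forall A B (f : cat_hom A B), cat_comp f (cat_id A) = f
}.
Arguments cat_id {c} A.
Arguments cat_comp {c A B C}.

Definition is_iso (C : category) (A B : C) (f : cat_hom A B) : Prop :=
  exists g : cat_hom B A,
    cat_comp g f = cat_id A /\ cat_comp f g = cat_id B.

Record functor (C D : category) := Functor {
  fobj :> C -> D;
  fmap : forall A B : C, cat_hom A B -> cat_hom (fobj A) (fobj B);
  fmap_id : forall A : C, fmap (cat_id A) = cat_id (fobj A);
  fmap_comp : forall (A B E : C) (g : cat_hom B E) (f : cat_hom A B),
    fmap (cat_comp g f) = cat_comp (fmap g) (fmap f)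
}.
Arguments fmap {C D} _ {A B}.

Definition functor_id (C : category) : functor C C :=
  @Functor C C id (fun _ _ => id) (fun _ => erefl) (fun _ _ _ _ _ => erefl).

Section FunctorComp.
Variables (C D E : category) (G : functor D E) (F : functor C D).

Definition functor_comp_fmap (A B : C) (f : cat_hom A B) := fmap G (fmap F f).

Lemma functor_comp_id (A : C) :
  functor_comp_fmap (cat_id A) = cat_id (G (F A)).
Proof. by rewrite /functor_comp_fmap !fmap_id. Qed.

Lemma functor_comp_comp (A B H : C) (g : cat_hom B H) (f : cat_hom A B) :
  functor_comp_fmap (cat_comp g f) =
  cat_comp (functor_comp_fmap g) (functor_comp_fmap f).
Proof. by rewrite /functor_comp_fmap !fmap_comp. Qed.

Definition functor_comp : functor C E :=
  @Functor C E (fun A => G (F A)) functor_comp_fmap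
    functor_comp_id functor_comp_comp.
End FunctorComp.

Lemma functor_compA (A B C D : category)
    (H : functor C D) (G : functor B C) (F : functor A B) :
  functor_comp H (functor_comp G F) = functor_comp (functor_comp H G) F.
Proof.
rewrite /functor_comp /=; congr Functor; exact: Prop_irrelevance.
Qed.

Lemma functor_comp1f (A B : category) (F : functor A B) :
  functor_comp (functor_id B) F = F.
Proof.
by case: F => F Ff F1 FM; congr Functor; exact: Prop_irrelevance.
Qed.

Lemma functor_compf1 (A B : category) (F : functor A B) :
  functor_comp F (functor_id A) = F.
Proof.
by case: F => F Ff F1 FM; congr Functor; exact: Prop_irrelevance.
Qed.

Definition nat_iso (C D : category) (F G : functor C D) : Prop :=
  exists s : forall A : C, cat_hom (F A) (G A),
    (forall A, is_iso (s A)) /\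
    (forall (A B : C) (f : cat_hom A B),
       cat_comp (fmap G f) (s A) = cat_comp (s B) (fmap F f)).

Section NatIso.

Lemma nat_iso_refl (C D : category) (F : functor C D) : nat_iso F F.
Proof.
exists (fun A => cat_id (F A)); split=> [A|A B f].
  by exists (cat_id (F A)); rewrite cat_comp1f.
by rewrite cat_comp1f cat_compf1.
Qed.

Lemma nat_iso_sym (C D : category) (F G : functor C D) :
  nat_iso F G -> nat_iso G F.
Proof.
move=> [s [si sn]]; pose r A := projT1 (cid (si A)).
have rP A : cat_comp (r A) (s A) = cat_id _ /\ cat_comp (s A) (r A) = cat_id _
  := projT2 (cid (si A)).
exists r; split=> [A|A B f].
  by exists (s A); case: (rP A).
have [rsA srA] := rP A; have [rsB srB] := rP B.
by rewrite -[LHS]cat_comp1f -rsB -cat_compA (cat_compA (s B)) -sn -cat_compA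
  srA cat_compf1.
Qed.

Lemma is_iso_comp (C : category) (A B E : C) (g : cat_hom B E) (f : cat_hom A B) :
  is_iso g -> is_iso f -> is_iso (cat_comp g f).
Proof.
move=> [g' [g'g gg']] [f' [f'f ff']]; exists (cat_comp f' g'); split.
  by rewrite -cat_compA (cat_compA g') g'g cat_comp1f.
by rewrite -cat_compA (cat_compA f) ff' cat_comp1f.
Qed.

Lemma nat_iso_trans (C D : category) (F G H : functor C D) :
  nat_iso F G -> nat_iso G H -> nat_iso F H.
Proof.
move=> [s [si sn]] [t [ti tn]]; exists (fun A => cat_comp (t A) (s A)).
split=> [A|A B f]; first exact: is_iso_comp.
by rewrite cat_compA tn -!cat_compA sn.
Qed.

Lemma nat_iso_whiskerl (C D E : category) (H : functor D E) (F G : functor C D) :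
  nat_iso F G -> nat_iso (functor_comp H F) (functor_comp H G).
Proof.
move=> [s [si sn]]; exists (fun A => fmap H (s A)); split=> [A|A B f].
  by case: (si A) => r [rs sr]; exists (fmap H r); rewrite /= -!fmap_comp rs sr !fmap_id.
by rewrite /= /functor_comp_fmap -!fmap_comp sn.
Qed.

Lemma nat_iso_whiskerr (C D E : category) (F G : functor D E) (H : functor C D) :
  nat_iso F G -> nat_iso (functor_comp F H) (functor_comp G H).
Proof.
move=> [s [si sn]]; exists (fun A => s (H A)).
by split=> [A|A B f]; [exact: si (H A) | exact: sn].
Qed.

End NatIso.

(* The inverse functor is part of the data only for convenience: it is unique, see
   [cat_aut_eq]. *)
Record cat_aut (C : category) := CatAut {
  ca_fun :> functor C C;
  ca_inv : functor C C;
  ca_funK : functor_comp ca_inv ca_fun = functor_id C;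
  ca_invK : functor_comp ca_fun ca_inv = functor_id C
}.

HB.instance Definition _ (C : category) := gen_eqMixin (cat_aut C).
HB.instance Definition _ (C : category) := gen_choiceMixin (cat_aut C).

Section CatAutGroup.
Variable C : category.

Lemma cat_aut_eq (F G : cat_aut C) : ca_fun F = ca_fun G -> F = G.
Proof.
case: F G => [F F' FK KF] [G G' GK KG] /= e; subst G.
have e : F' = G'.
  by rewrite -[F']functor_compf1 -KG functor_compA FK functor_comp1f.
by subst G'; congr CatAut; apply: Prop_irrelevance.
Qed.

Definition cat_aut_one : cat_aut C :=
  @CatAut C (functor_id C) (functor_id C) (functor_comp1f _) (functor_comp1f _).

Lemma cat_aut_mul_subproof (F F' G G' : functor C C) :
  functor_comp F' F = functor_id C -> functor_comp G' G = functor_id C ->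
  functor_comp (functor_comp G' F') (functor_comp F G) = functor_id C.
Proof.
move=> FK GK.
by rewrite -functor_compA (functor_compA F') FK functor_comp1f GK.
Qed.

Definition cat_aut_mul (F G : cat_aut C) : cat_aut C :=
  CatAut (cat_aut_mul_subproof (ca_funK F) (ca_funK G))
         (cat_aut_mul_subproof (ca_invK G) (ca_invK F)).

Definition cat_aut_inv (F : cat_aut C) : cat_aut C :=
  CatAut (ca_invK F) (ca_funK F).

Lemma cat_aut_mulA : associative cat_aut_mul.
Proof. by move=> F G H; apply: cat_aut_eq; apply: functor_compA. Qed.

Lemma cat_aut_mul1 : left_id cat_aut_one cat_aut_mul.
Proof. by move=> F; apply: cat_aut_eq; apply: functor_comp1f. Qed.

Lemma cat_aut_mulr1 : right_id cat_aut_one cat_aut_mul.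
Proof. by move=> F; apply: cat_aut_eq; apply: functor_compf1. Qed.

Lemma cat_aut_mulV : left_inverse cat_aut_one cat_aut_inv cat_aut_mul.
Proof. by move=> F; apply: cat_aut_eq; apply: ca_funK. Qed.

Lemma cat_aut_mulrV : right_inverse cat_aut_one cat_aut_inv cat_aut_mul.
Proof. by move=> F; apply: cat_aut_eq; apply: ca_invK. Qed.

HB.instance Definition _ := isGroup.Build (cat_aut C)
  cat_aut_mulA cat_aut_mul1 cat_aut_mulr1 cat_aut_mulV cat_aut_mulrV.

End CatAutGroup.

(* Normal subgroups and quotients of possibly infinite groups (MathComp's
   quotients are restricted to [finGroupType]). *)

Record normalSubgroup (G : groupType) := NormalSubgroup {
  nsg_mem :> G -> Prop;
  nsg1 : nsg_mem 1%g;
  nsgM : forall x y, nsg_mem x -> nsg_mem y -> nsg_mem (x * y)%g;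
  nsgV : forall x, nsg_mem x -> nsg_mem (x^-1)%g;
  nsgJ : forall x y, nsg_mem x -> nsg_mem (x ^ y)%g
}.

Section QuotientGroup.
Local Open Scope group_scope.
Variables (G : groupType) (N : normalSubgroup G).

Definition coset_equivb (x y : G) : bool := `[< N (x^-1 * y) >].

Lemma coset_equiv_class_of : equiv_class_of coset_equivb.
Proof.
split=> [x|x y|y x z].
- by apply/asboolP; rewrite mulVg; apply: nsg1.
- by apply/asboolP/asboolP => /nsgV; rewrite invgM invgK.
- move=> /asboolP H1 /asboolP H2; apply/asboolP.
  by have := nsgM H1 H2; rewrite mulgA mulgK.
Qed.

Canonical coset_equiv_rel := EquivRelPack coset_equiv_class_of.

Definition quotientGroup : Type := {eq_quot coset_equiv_rel}%qT.
HB.instance Definition _ := Choice.on quotientGroup.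

Definition qg_class (x : G) : quotientGroup :=
  (\pi_{eq_quot coset_equiv_rel} x)%qT.
Definition qg_repr (x : quotientGroup) : G :=
  repr (x : {eq_quot coset_equiv_rel}%qT).

Lemma qg_reprK x : qg_class (qg_repr x) = x.
Proof. exact: reprK. Qed.

Lemma qg_classP x y : qg_class x = qg_class y <-> N (x^-1 * y).
Proof.
rewrite /qg_class; split=> [/eqquotP /asboolP //|H].
by apply/eqquotP/asboolP.
Qed.

Definition qg_one : quotientGroup := qg_class 1.
Definition qg_mul (x y : quotientGroup) := qg_class (qg_repr x * qg_repr y).
Definition qg_inv (x : quotientGroup) := qg_class (qg_repr x)^-1.

Lemma qg_class_ind (P : quotientGroup -> Prop) :
  (forall x, P (qg_class x)) -> forall x, P x.
Proof. by move=> H x; rewrite -(qg_reprK x). Qed.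

Lemma qg_mul_class x y : qg_mul (qg_class x) (qg_class y) = qg_class (x * y).
Proof.
apply/qg_classP; set x' := qg_repr _; set y' := qg_repr _.
have Hx : N (x'^-1 * x) by apply/qg_classP; rewrite qg_reprK.
have Hy : N (y'^-1 * y) by apply/qg_classP; rewrite qg_reprK.
have := nsgM (nsgJ y' Hx) Hy; rewrite /conjg invgM.
by rewrite !mulgA mulgK.
Qed.

Lemma qg_inv_class x : qg_inv (qg_class x) = qg_class x^-1.
Proof.
apply/qg_classP; set x' := qg_repr _.
have Hx : N (x'^-1 * x) by apply/qg_classP; rewrite qg_reprK.
by have := nsgJ x'^-1 (nsgV Hx); rewrite /conjg invgM !invgK -!mulgA mulgV mulg1.
Qed.

Lemma qg_mulA : associative qg_mul.
Proof.
elim/qg_class_ind=> x; elim/qg_class_ind=> y; elim/qg_class_ind=> z.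
by rewrite !qg_mul_class mulgA.
Qed.

Lemma qg_mul1 : left_id qg_one qg_mul.
Proof. by elim/qg_class_ind=> x; rewrite qg_mul_class mul1g. Qed.

Lemma qg_mulr1 : right_id qg_one qg_mul.
Proof. by elim/qg_class_ind=> x; rewrite qg_mul_class mulg1. Qed.

Lemma qg_mulV : left_inverse qg_one qg_inv qg_mul.
Proof. by elim/qg_class_ind=> x; rewrite qg_inv_class qg_mul_class mulVg. Qed.

Lemma qg_mulrV : right_inverse qg_one qg_inv qg_mul.
Proof. by elim/qg_class_ind=> x; rewrite qg_inv_class qg_mul_class mulgV. Qed.

HB.instance Definition _ := isGroup.Build quotientGroup
  qg_mulA qg_mul1 qg_mulr1 qg_mulV qg_mulrV.

End QuotientGroup.

Definition group_isomorphic (G H : groupType) : Prop :=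
  exists f : {multiplicative G -> H}, bijective f.

Section Inner.
Variable C : category.

Definition is_inner (F : cat_aut C) : Prop := nat_iso (functor_id C) F.

Lemma inner1 : is_inner 1%g.
Proof. exact: nat_iso_refl. Qed.

Lemma innerM (F G : cat_aut C) :
  is_inner F -> is_inner G -> is_inner (F * G)%g.
Proof.
move=> iF iG; apply: (nat_iso_trans iF).
by have := nat_iso_whiskerl F iG; rewrite functor_compf1.
Qed.

Lemma innerV (F : cat_aut C) : is_inner F -> is_inner (F^-1)%g.
Proof.
move=> /(nat_iso_whiskerl (ca_inv F)); rewrite functor_compf1 ca_funK.
exact: nat_iso_sym.
Qed.

Lemma innerJ (F G : cat_aut C) : is_inner F -> is_inner (F ^ G)%g.
Proof.
move=> /(nat_iso_whiskerr G)/(nat_iso_whiskerl (ca_inv G)).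
by rewrite functor_comp1f ca_funK.
Qed.

Definition inner_auts : normalSubgroup (cat_aut C) :=
  NormalSubgroup inner1 innerM innerV innerJ.

End Inner.

Record fieldAut (k : fieldType) := FieldAut {
  fa_fun :> {rmorphism k -> k};
  fa_inv : {rmorphism k -> k};
  fa_funK : cancel fa_fun fa_inv;
  fa_invK : cancel fa_inv fa_fun
}.

HB.instance Definition _ (k : fieldType) := gen_eqMixin (fieldAut k).
HB.instance Definition _ (k : fieldType) := gen_choiceMixin (fieldAut k).

Section FieldAutGroup.
Variable k : fieldType.

Lemma rmorphism_eq (f g : {rmorphism k -> k}) : f =1 g -> f = g.
Proof.
case: f g => [f [[f1] [f2]]] [g [[g1] [g2]]] /= /funext e; subst g.
by rewrite (Prop_irrelevance f1 g1) (Prop_irrelevance f2 g2).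
Qed.

Lemma fieldAut_eq (f g : fieldAut k) : f =1 g -> f = g.
Proof.
case: f g => [f f' fK Kf] [g g' gK Kg] /= e.
have e1 := rmorphism_eq e; subst g.
have e2 : f' = g' by apply: rmorphism_eq => x; rewrite -{1}(Kg x) fK.
by subst g'; congr FieldAut; apply: Prop_irrelevance.
Qed.

Definition fieldAut_one : fieldAut k :=
  @FieldAut k idfun idfun (fun _ => erefl) (fun _ => erefl).

Definition fieldAut_mul (f g : fieldAut k) : fieldAut k :=
  @FieldAut k (f \o g) (fa_inv g \o fa_inv f)
    (can_comp (fa_funK f) (fa_funK g)) (can_comp (fa_invK g) (fa_invK f)).

Definition fieldAut_inv (f : fieldAut k) : fieldAut k :=
  FieldAut (fa_invK f) (fa_funK f).

Lemma fieldAut_mulA : associative fieldAut_mul.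
Proof. by move=> f g h; apply: fieldAut_eq. Qed.

Lemma fieldAut_mul1 : left_id fieldAut_one fieldAut_mul.
Proof. by move=> f; apply: fieldAut_eq. Qed.

Lemma fieldAut_mulr1 : right_id fieldAut_one fieldAut_mul.
Proof. by move=> f; apply: fieldAut_eq. Qed.

Lemma fieldAut_mulV : left_inverse fieldAut_one fieldAut_inv fieldAut_mul.
Proof. by move=> f; apply: fieldAut_eq => x; apply: fa_funK. Qed.

Lemma fieldAut_mulrV : right_inverse fieldAut_one fieldAut_inv fieldAut_mul.
Proof. by move=> f; apply: fieldAut_eq => x; apply: fa_invK. Qed.

HB.instance Definition _ := isGroup.Build (fieldAut k)
  fieldAut_mulA fieldAut_mul1 fieldAut_mulr1 fieldAut_mulV fieldAut_mulrV.

End FieldAutGroup.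

(* The category Theta^0: X_0 is [nat], and the object F(X) is represented by the
   finite subset X of X_0. *)

Definition freeJordanAlg (k : fieldType) (X : {fset nat}) : jordanAlgType k :=
  freeJordan k X.

Section FreeJordanCat.
Variable k : fieldType.

Definition freeJordanHom (X Y : {fset nat}) : Type :=
  algHom (freeJordanAlg k X) (freeJordanAlg k Y).

Definition freeJordanCat : category :=
  @Category {fset nat} freeJordanHom
    (fun X => algHom_id (freeJordanAlg k X))
    (fun X Y Z g f => algHom_comp g f)
    (fun X Y Z T h g f => algHom_compA h g f)
    (fun X Y f => algHom_comp1f f)
    (fun X Y f => algHom_compf1 f).

End FreeJordanCat.

(* Main.v *)
Require Import Defs.
From HB Require Import structures.
From mathcomp Require Import all_boot all_order all_algebra.
From mathcomp Require Import finmap boolp.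

Set Implicit Arguments.
Unset Strict Implicit.
Unset Printing Implicit Defensive.

Import GRing.Theory.
Local Open Scope ring_scope.

(* Let F be an automorphism of the category. Jordan algebras are power-associative,
   so the free algebra on one generator x is xk[x]; comparing degrees of composites,
   its automorphisms are the maps x |-> c x, and F maps it to a free algebra on one
   generator y. Since a in F(X) is the same as a homomorphism x |-> a, F induces
   natural bijections s : F(X) -> F(F X), s a := F(x |-> a) y, with
   s (c a) = phi(c) s a for some bijection phi of k. Let w in F({x0, x1}) satisfy
   s w = s x0 + s x1. The substitution x_i |-> 2 x_i multiplies w by 2; as w is a
   sum of homogeneous elements on which it acts by distinct powers of 2, w is linear,
   and in fact w = x0 + x1, so that s and phi are additive. The same argument in each
   variable gives s a * s b = c s (a * b) for a nonzero constant c, which is absorbed by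
   rescaling s. So F is implemented by natural phi-semilinear isomorphisms; phi is
   determined by F, is multiplicative in F, is the identity exactly when F is inner,
   and every field automorphism arises by twisting the scalars. *)

(* Equality of sums in an additive group up to reordering. *)
Ltac zmod_ac :=
  rewrite -?addrA;
  do 150 try match goal with
  | |- ?x = ?x => reflexivity
  | |- ?x + _ = ?y + _ => unify x y; refine (congr1 (+%R x) _)
  | |- _ = _ + _ => rewrite [RHS]addrC -?addrA
  end.

(** * Polarization of a trilinear map vanishing on the diagonal *)

Section TrilinearPolarization.
Variables (k : fieldType) (V : lmodType k) (T : V -> V -> V -> V).
Hypothesis two_neq0 : (2%:R : k) != 0.
Hypothesis TD1 : forall a a' b c, T (a + a') b c = T a b c + T a' b c.
Hypothesis TD3 : forall a b c c', T a b (c + c') = T a b c + T a b c'.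
Hypothesis Tsym : forall a b c, T a b c = T b a c.
Hypothesis Tdiag : forall a, T a a a = 0.

Lemma double_eq0 (x : V) : x + x = 0 -> x = 0.
Proof.
move=> xx; apply/eqP; have : 2%:R *: x = 0 by rewrite scaler_nat.
by move/eqP; rewrite scaler_eq0 (negPf two_neq0).
Qed.

Lemma trilinear_polarization a b c : T a b c + T b c a + T c a b = 0.
Proof.
have TD2 x y y' z : T x (y + y') z = T x y z + T x y' z.
  by rewrite Tsym TD1 !(Tsym _ x).
have T0 x y : T x y 0 = 0 by apply: (addrI (T x y 0)); rewrite -TD3 !addr0.
have T01 x y : T 0 x y = 0 by apply: (addrI (T 0 x y)); rewrite -TD1 !addr0.
have TN3 x y z : T x y (- z) = - T x y z.
  by apply: (addrI (T x y z)); rewrite -TD3 !subrr T0.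
have TN1 x y z : T (- x) y z = - T x y z.
  by apply: (addrI (T x y z)); rewrite -TD1 !subrr T01.
have TN2 x y z : T x (- y) z = - T x y z by rewrite Tsym TN1 Tsym.
(* [A] and [B] are the parts of [T] at [x + y] of degree 2 and 1 in [x]. Replacing [y] by [- y]
   separates them. *)
have U0 x y : T y y x + (T x y y + T x y y) = 0.
  pose A := T x x y + (T x y x + T x y x); pose B := T y y x + (T x y y + T x y y).
  have Ap : A + B = 0.
    rewrite -(Tdiag (x + y)) TD1 !TD2 !TD3 !Tdiag !(Tsym y x) add0r addr0.
    by rewrite /A /B; zmod_ac.
  have Am : - A + B = 0.
    rewrite -(Tdiag (x - y)) TD1 !TD2 !TD3 !(TN1, TN2, TN3) !Tdiag !opprK !(Tsym y x).
    by rewrite oppr0 add0r addr0 /A /B !opprD; zmod_ac.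
  apply: double_eq0; transitivity (A + B + (- A + B)); last by rewrite Ap Am addr0.
  by rewrite [RHS]addrACA subrr add0r.
apply: double_eq0.
set X := T a b c + _ + _.
(* [Y] sums the expressions killed by [U0] at [(a, b)] and [(a, c)]; the one at [(a, b + c)] is [Y]
   plus twice [X]. *)
pose Y := T b b a + (T a b b + T a b b) + (T c c a + (T a c c + T a c c)).
transitivity (X + X + Y); first by rewrite /Y !U0 !addr0.
rewrite -[RHS](U0 a (b + c)) TD1 !TD2 !TD3 /X /Y (Tsym c b a) (Tsym c a b).
by zmod_ac.
Qed.
End TrilinearPolarization.

(** * Target Jordan algebras: polynomials and scalar twists *)

Definition polyJ (k : fieldType) : Type := {poly k}.

HB.instance Definition _ (k : fieldType) := GRing.Lmodule.on (polyJ k).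

HB.instance Definition _ (k : fieldType) := hasMul.Build (polyJ k) (fun p q : {poly k} => p * q).

Section PolyJ.
Variable k : fieldType.

Lemma polyJ_mulE (p q : polyJ k) : (p * q)%g = (p : {poly k}) * (q : {poly k}).
Proof. by []. Qed.

HB.instance Definition _ := isLinearAlgebra.Build k (polyJ k)
  (fun x y z : {poly k} => mulrDl x y z) (fun x y z : {poly k} => mulrDr x y z)
  (fun a (x y : {poly k}) => esym (scalerAl a x y))
  (fun a (x y : {poly k}) => esym (scalerAr a x y)).

Lemma polyJ_mulC (x y : polyJ k) : (x * y = y * x)%g.
Proof. exact: mulrC. Qed.

Lemma polyJ_identity (x y : polyJ k) : (((x * x) * y) * x = (x * x) * (y * x))%g.
Proof. by rewrite !polyJ_mulE mulrA. Qed.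

HB.instance Definition _ := isJordan.Build k (polyJ k) polyJ_mulC polyJ_identity.

End PolyJ.

(** A [phi]-semilinear map into [J] is a linear map into [twist phi J], so the universal property of
    free algebras yields semilinear maps. *)
Definition twist (k : fieldType) (phi : {rmorphism k -> k}) (J : Type) : Type := J.

Section Twist.
Variables (k : fieldType) (phi : {rmorphism k -> k}) (J : jordanAlgType k).

HB.instance Definition _ := GRing.Zmodule.copy (twist phi J) J.

HB.instance Definition _ := ChoiceMagma.copy (twist phi J) J.

Definition twist_scale (a : k) (x : twist phi J) : twist phi J := phi a *: (x : J).

Lemma twist_scaleA a b x : twist_scale a (twist_scale b x) = twist_scale (a * b) x.
Proof. by rewrite /twist_scale scalerA rmorphM. Qed.

Lemma twist_scale1 : left_id 1 twist_scale.
Proof. by move=> x; rewrite /twist_scale rmorph1 scale1r. Qed.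

Lemma twist_scaleDr : right_distributive twist_scale +%R.
Proof. by move=> a x y; exact: scalerDr. Qed.

Lemma twist_scaleDl x : {morph twist_scale^~ x : a b / a + b}.
Proof. by move=> a b; rewrite /twist_scale rmorphD; exact: scalerDl. Qed.

HB.instance Definition _ := GRing.Zmodule_isLmodule.Build k (twist phi J)
  twist_scaleA twist_scale1 twist_scaleDr twist_scaleDl.

HB.instance Definition _ := isLinearAlgebra.Build k (twist phi J)
  (@la_mulDl k J) (@la_mulDr k J)
  (fun a => @la_scaleAl k J (phi a)) (fun a => @la_scaleAr k J (phi a)).

HB.instance Definition _ := isJordan.Build k (twist phi J)
  (@jordan_mulC k J) (@jordan_identity k J).

End Twist.

(** * Elementary rules for homomorphisms and products *)

Section AlgHomTheory.
Variables (k : fieldType) (A B : linAlgType k) (f : algHom A B).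

Lemma algHomD : {morph f : x y / x + y}.
Proof. by move=> x y; have := algHom_linear f 1 x y; rewrite !scale1r. Qed.

Lemma algHom0 : f 0 = 0.
Proof. by apply: (addrI (f 0)); rewrite -algHomD !addr0. Qed.

Lemma algHomZ a : {morph f : x / a *: x}.
Proof. by move=> x; rewrite -[a *: x]addr0 algHom_linear algHom0 addr0. Qed.

Lemma algHom_sum I (r : seq I) (P : pred I) (F : I -> A) :
  f (\sum_(i <- r | P i) F i) = \sum_(i <- r | P i) f (F i).
Proof. exact: (big_morph f algHomD algHom0). Qed.
End AlgHomTheory.

Section LinearAlgebraTheory.
Variables (k : fieldType) (A : linAlgType k).

Lemma la_mul0l (x : A) : (0 * x)%g = 0.
Proof. by apply: (addrI (0 * x)%g); rewrite -la_mulDl !addr0. Qed.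

Lemma la_mul0r (x : A) : (x * 0)%g = 0.
Proof. by apply: (addrI (x * 0)%g); rewrite -la_mulDr !addr0. Qed.

Lemma la_mulNr (x y : A) : (x * (- y)%R)%g = - (x * y)%g.
Proof. by rewrite -scaleN1r la_scaleAr scaleN1r. Qed.

Lemma la_mul_suml I (r : seq I) (F : I -> A) y :
  ((\sum_(i <- r) F i)%R * y)%g = \sum_(i <- r) (F i * y)%g.
Proof. by elim: r => [|i r IH]; rewrite ?big_nil ?la_mul0l // !big_cons la_mulDl IH. Qed.

Lemma la_mul_sumr I (r : seq I) (F : I -> A) y :
  (y * (\sum_(i <- r) F i)%R)%g = \sum_(i <- r) (y * F i)%g.
Proof. by elim: r => [|i r IH]; rewrite ?big_nil ?la_mul0r // !big_cons la_mulDr IH. Qed.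
End LinearAlgebraTheory.

(** * Power associativity of Jordan algebras *)

Section PowerAssociativity.
Variables (k : fieldType) (J : jordanAlgType k).
Hypothesis two_neq0 : (2%:R : k) != 0.
Implicit Types a b c x y : J.

(** The Jordan identity says that the associator [T] of [a * b], [y] and [c] vanishes for
    [a = b = c]; this is its polarization. *)
Lemma jordan_linearized a b c y :
  ((a * b * y * c)%g + (b * c * y * a)%g + (c * a * y * b)%g =
   (a * b * (y * c))%g + (b * c * (y * a))%g + (c * a * (y * b))%g :> J)%R.
Proof.
pose T a b c : J := (a * b * y * c)%g - (a * b * (y * c))%g.
have TD1 a1 a2 b' c' : T (a1 + a2) b' c' = T a1 b' c' + T a2 b' c'.
  by rewrite /T !la_mulDl opprD addrACA.
have TD3 a' b' c1 c2 : T a' b' (c1 + c2) = T a' b' c1 + T a' b' c2.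
  by rewrite /T !la_mulDr opprD addrACA.
have Ts a' b' c' : T a' b' c' = T b' a' c' by rewrite /T (jordan_mulC a').
have Td a' : T a' a' a' = 0 by rewrite /T jordan_identity subrr.
have := trilinear_polarization two_neq0 TD1 TD3 Ts Td a b c; rewrite /T => E.
apply/eqP; rewrite -subr_eq0 -[X in _ == X]E; apply/eqP.
by rewrite !opprD; zmod_ac.
Qed.

(* There is no unit: [jpow a n] is the power of exponent [n + 1]. *)
Fixpoint jpow a n : J := if n is m.+1 then (a * jpow a m)%g else a.

(** This is [jordan_linearized] at [a], [jpow a n], [w] with [y := a], solved for its first term. *)
Lemma jpow_rec a n w :
  (jpow a n.+2 * w)%g =
    (jpow a n.+1 * (a * w))%g + (jpow a 1 * (jpow a n * w))%g
    + (jpow a n.+1 * (a * w))%g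
    - ((a * (a * (jpow a n * w)))%g + (jpow a n * (a * (a * w)))%g).
Proof.
have := jordan_linearized a (jpow a n) w a.
rewrite (jordan_mulC (jpow a n.+1) a) -/(jpow a n.+2).
rewrite (jordan_mulC _ a) (jordan_mulC _ a) (jordan_mulC _ (jpow a n)).
rewrite (jordan_mulC w a) (jordan_mulC (jpow a n * w)%g (a * a)%g).
rewrite (jordan_mulC _ (a * jpow a n)%g) (jordan_mulC (a * w)%g a) => <-.
by rewrite -[X in X - _]addrA addrK.
Qed.

(* By [jpow_rec] and induction, the multiplication by each power of [a] is a polynomial in
   the commuting multiplications by [a] and [a * a]. *)
Lemma jpow_comm a n w : (jpow a n * (a * w))%g = (a * (jpow a n * w))%g.
Proof.
elim/ltn_ind: n w => -[|[|n]] // IH w.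
  by rewrite /= (jordan_mulC a w) -jordan_identity jordan_mulC.
have c0 := IH n (ltnW (ltnSn _)); have c1 := IH n.+1 (ltnSn _).
have c2 v : (jpow a 1 * (a * v))%g = (a * (jpow a 1 * v))%g.
  by rewrite /= (jordan_mulC a v) -jordan_identity jordan_mulC.
rewrite !jpow_rec la_mulDr la_mulNr !la_mulDr.
by rewrite !(c0, c1, c2).
Qed.

(** Exponents are shifted by one, so [m + 1] and [n + 1] add up to [(m + n).+1 + 1]. *)
Lemma jpowD a m n : (jpow a m * jpow a n)%g = jpow a (m + n).+1%N.
Proof.
elim: m => [|m IH] //=.
by rewrite jordan_mulC jpow_comm (jordan_mulC (jpow a n)) IH.
Qed.
End PowerAssociativity.

(** * Nonassociative monomials and expansion of terms *)

Inductive monomial (X : Type) : Type :=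
  | MVar of X
  | MMul of monomial X & monomial X.

Section Monomials.
Variables (k : fieldType) (X : Type).

Fixpoint mon_eval (A : linAlgType k) (v : X -> A) (m : monomial X) : A :=
  match m with
  | MVar x => v x
  | MMul m1 m2 => (mon_eval v m1 * mon_eval v m2)%g
  end.

Fixpoint mon_weight (w : X -> nat) (m : monomial X) : nat :=
  match m with
  | MVar x => w x
  | MMul m1 m2 => (mon_weight w m1 + mon_weight w m2)%N
  end.

Definition msum (A : linAlgType k) (v : X -> A) (l : seq (k * monomial X)) : A :=
  \sum_(p <- l) p.1 *: mon_eval v p.2.

(** This is no normal form: monomials may repeat, and distinct ones may agree in all Jordan
    algebras. *)
Fixpoint expand (t : algTerm k X) : seq (k * monomial X) :=
  match t with
  | Var x => [:: (1, MVar x)]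
  | Zero => [::]
  | Add t u => expand t ++ expand u
  | Mul t u => [seq (p.1 * q.1, MMul p.2 q.2) | p <- expand t, q <- expand u]
  | Scale a t => [seq (a * p.1, p.2) | p <- expand t]
  end.

Lemma msum_expand (A : linAlgType k) (v : X -> A) t : msum v (expand t) = eval v t.
Proof.
rewrite /msum; elim: t => [x||t IHt u IHu|t IHt u IHu|a t IHt] /=.
- by rewrite big_seq1 scale1r.
- by rewrite big_nil.
- by rewrite big_cat IHt IHu.
- rewrite big_allpairs_dep -IHt -IHu la_mul_suml; apply: eq_bigr => p _.
  rewrite la_mul_sumr; apply: eq_bigr => q _ /=.
  by rewrite la_scaleAl la_scaleAr scalerA.
- by rewrite big_map -IHt scaler_sumr; apply: eq_bigr => p _; rewrite scalerA.
Qed.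

Lemma algHom_mon_eval (A B : linAlgType k) (f : algHom A B) (v : X -> A) m :
  f (mon_eval v m) = mon_eval (f \o v) m.
Proof. by elim: m => //= m1 IH1 m2 IH2; rewrite algHom_mul IH1 IH2. Qed.

Lemma algHom_msum (A B : linAlgType k) (f : algHom A B) (v : X -> A) l :
  f (msum v l) = msum (f \o v) l.
Proof.
by rewrite /msum algHom_sum; apply: eq_bigr => p _; rewrite algHomZ algHom_mon_eval.
Qed.

Lemma mon_eval_scale (A : linAlgType k) (v : X -> A) (w : X -> nat) (t : k) m :
  mon_eval (fun x => t ^+ w x *: v x) m = t ^+ mon_weight w m *: mon_eval v m.
Proof.
elim: m => //= m1 -> m2 ->.
by rewrite la_scaleAl la_scaleAr scalerA -exprD.
Qed.

Lemma freeJordan_msum (f : freeJordan k X) : exists l, f = msum (@fj_var k X) l.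
Proof.
exists (expand (fj_repr f)); rewrite msum_expand.
(* By uniqueness the identity is the lift of the generators, so [f] is its representative evaluated
   at the generators. *)
have /(congr1 (fun g : algHom _ _ => g f)) :=
  @fj_lift_unique k X _ (@fj_var k X) (algHom_id _) (fun _ => erefl).
by [].
Qed.

Lemma freeJordan_hom_ext (A : linAlgType k) (f g : algHom (freeJordan k X : linAlgType k) A) :
  (forall x, f (fj_var k x) = g (fj_var k x)) -> f =1 g.
Proof.
move=> fg a; have [l ->] := freeJordan_msum a; rewrite !algHom_msum.
by have -> : f \o @fj_var k X = g \o @fj_var k X by apply/funext => x /=.
Qed.
End Monomials.

(** * Weight components as eigenvectors *)

Section Homogeneous.
Variable k : fieldType.
Variable t : k.
Hypothesis t_inj : forall i j : nat, t ^+ i = t ^+ j -> i = j.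

(** Eigenvectors for distinct eigenvalues are independent: [s] minus [t ^+ N] kills the last term
    and leaves a shorter relation. *)
Lemma eigen_sum0 (A : linAlgType k) (s : algHom A A) N (c : nat -> A) :
  (forall d, s (c d) = t ^+ d *: c d) -> \sum_(d < N) c d = 0 ->
  forall d, (d < N)%N -> c d = 0.
Proof.
elim: N c => // N IH c sc c0 d; rewrite ltnS.
have cd0 e : (e < N)%N -> c e = 0.
  move=> eN; have /(_ e eN) : forall e, (e < N)%N -> (t ^+ e - t ^+ N) *: c e = 0.
    apply: IH => [e'|]; first by rewrite algHomZ sc !scalerA mulrC.
    have : s (\sum_(d < N.+1) c d) - t ^+ N *: \sum_(d < N.+1) c d = 0.
      by rewrite c0 algHom0 scaler0 subrr.
    rewrite algHom_sum scaler_sumr -sumrB big_ord_recr /= sc subrr addr0 => E.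
    by rewrite -[RHS]E; apply: eq_bigr => i _; rewrite sc scalerBl.
  move/eqP; rewrite scaler_eq0 subr_eq0 => /orP[/eqP /t_inj eeN|/eqP //].
  by rewrite eeN ltnn in eN.
rewrite leq_eqVlt => /orP[/eqP ->|]; last exact: cd0.
move: c0; rewrite big_ord_recr /= big1 ?add0r => [//|i _]; exact: cd0 (ltn_ord i).
Qed.

(** Every cutoff from [N] on is allowed, so that two elements can share one. *)
Lemma msum_graded (A : linAlgType k) X (v : X -> A) w l :
  exists N, forall n, (N <= n)%N ->
    msum v l = \sum_(d < n) msum v [seq p <- l | mon_weight w p.2 == d].
Proof.
elim: l => [|p l [N IH]].
  by exists 0 => n _; rewrite big1 /msum ?big_nil // => d _; rewrite big_nil.
exists (maxn N (mon_weight w p.2).+1) => n; rewrite geq_max => /andP[Nn pn].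
rewrite {1}/msum big_cons -/(msum v l) (IH n Nn) (bigD1 (Ordinal pn)) //=
  [RHS](bigD1 (Ordinal pn)) //=.
rewrite eqxx /msum big_cons addrA; congr (_ + _); apply: eq_bigr => d /negPf dp.
by rewrite (_ : (_ == _ :> nat) = false) // eq_sym.
Qed.

(** Applying [s] minus [t ^+ e] gives 0 and multiplies the component of weight [d] by
    [t ^+ d - t ^+ e]; by independence only weight [e] survives. *)
Lemma msum_weight (A : linAlgType k) (s : algHom A A) X (v : X -> A) w l e :
  (forall x, s (v x) = t ^+ w x *: v x) -> s (msum v l) = t ^+ e *: msum v l ->
  msum v l = msum v [seq p <- l | mon_weight w p.2 == e].
Proof.
move=> sv sl.
pose c d := msum v [seq p <- l | mon_weight w p.2 == d].
have sc d : s (c d) = t ^+ d *: c d.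
  rewrite /c algHom_msum /msum scaler_sumr !big_filter; apply: eq_bigr => p /eqP <-.
  have -> : s \o v = (fun x => t ^+ w x *: v x) by apply/funext => x /=.
  by rewrite mon_eval_scale !scalerA mulrC.
have [N /(_ (N + e).+1%N (leq_trans (leq_addr _ _) (leqnSn _))) lN] := msum_graded v w l.
have e_lt : (e < (N + e).+1)%N by rewrite ltnS leq_addl.
rewrite lN (bigD1 (Ordinal e_lt)) //= big1 ?addr0 // => d /negPf de.
have /(_ d (ltn_ord d)) : forall d, (d < (N + e).+1)%N -> (t ^+ d - t ^+ e) *: c d = 0.
  apply: (eigen_sum0 (s := s)) => [d'|]; first by rewrite algHomZ sc !scalerA mulrC.
  have : s (msum v l) - t ^+ e *: msum v l = 0 by rewrite sl subrr.
  rewrite lN algHom_sum scaler_sumr -sumrB => E.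
  by rewrite -[RHS]E; apply: eq_bigr => i _; rewrite sc scalerBl.
move/eqP; rewrite scaler_eq0 subr_eq0 => /orP[/eqP /t_inj d_e|/eqP //].
by move: de; rewrite -val_eqE /= d_e eqxx.
Qed.
End Homogeneous.

(** * The free algebra on one generator *)

Section SingleGenerator.
Variables (k : fieldType) (X : Type) (x0 : X).
Hypothesis two_neq0 : (2%:R : k) != 0.
Hypothesis X1 : forall x, x = x0.
Implicit Types f g : freeJordan k X.

Definition to_poly : algHom (freeJordan k X : linAlgType k) (polyJ k) :=
  fj_lift (fun _ => ('X : {poly k}) : polyJ k).

Definition degree : monomial X -> nat := mon_weight (fun=> 1%N).

Lemma degree_gt0 m : (0 < degree m)%N.
Proof. by elim: m => //= m1 IH1 m2 IH2; rewrite /degree /= addn_gt0 IH1. Qed.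

Lemma mon_eval_jpow m : mon_eval (@fj_var k X) m = jpow (fj_var k x0) (degree m).-1.
Proof.
elim: m => [x|m1 IH1 m2 IH2] /=; first by rewrite (X1 x).
rewrite IH1 IH2 jpowD // [degree (MMul _ _)]/(degree m1 + degree m2)%N.
by case: (degree m1) (degree_gt0 m1) (degree m2) (degree_gt0 m2) => [|a] // _ [|b] // _;
  rewrite plusE addnS.
Qed.

Lemma to_poly_mon_eval m : to_poly (mon_eval (@fj_var k X) m) = 'X^(degree m).
Proof.
rewrite algHom_mon_eval; elim: m => [x|m1 IH1 m2 IH2] /=.
  by rewrite fj_eval_class.
by rewrite IH1 IH2 polyJ_mulE -exprD.
Qed.

Lemma coef_to_poly l d :
  (to_poly (msum (@fj_var k X) l) : {poly k})`_d = \sum_(p <- l | degree p.2 == d) p.1.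
Proof.
rewrite /msum algHom_sum.
elim: l => [|p l IH]; first by rewrite !big_nil coef0.
rewrite !big_cons coefD IH algHomZ to_poly_mon_eval coefZ coefXn eq_sym.
by case: eqP => _; rewrite ?mulr1 ?mulr0 ?add0r.
Qed.

Lemma to_poly_coef0 f : (to_poly f : {poly k})`_0 = 0.
Proof.
have [l ->] := freeJordan_msum f; rewrite coef_to_poly big1 // => p.
by rewrite eqn0Ngt degree_gt0.
Qed.

(** Degree [d] is index [d.-1] of [jpow]; at [d = 0] this index is a default value, harmless by
    [to_poly_coef0]. *)
Lemma to_poly_expansion f :
  exists N, forall n, (N <= n)%N ->
    f = \sum_(d < n) (to_poly f : {poly k})`_d *: jpow (fj_var k x0) d.-1.
Proof.
have [l ->] := freeJordan_msum f.
have [N lN] := msum_graded (@fj_var k X) (fun=> 1%N) l.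
exists N => n /lN {1}->; apply: eq_bigr => d _.
rewrite coef_to_poly /msum big_filter scaler_suml; apply: eq_bigr => p /eqP <-.
by rewrite mon_eval_jpow.
Qed.

Lemma to_poly_inj f g : to_poly f = to_poly g -> f = g.
Proof.
move=> fg; have [N fN] := to_poly_expansion f; have [M gM] := to_poly_expansion g.
by rewrite (fN _ (leq_maxl N M)) (gM _ (leq_maxr N M)) fg.
Qed.

Definition comp_polyJ (q : {poly k}) : algHom (polyJ k) (polyJ k) :=
  @AlgHom k (polyJ k) (polyJ k) (fun p : {poly k} => p \Po q)
    (fun a p p' => etrans (comp_polyD _ _ q) (congr1 (+%R^~ _) (comp_polyZ a p q)))
    (fun p p' => comp_polyM p p' q).

Lemma to_poly_comp (e : algHom (freeJordan k X : linAlgType k) (polyJ k)) f :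
  e f = (to_poly f : {poly k}) \Po (e (fj_var k x0)).
Proof.
rewrite -[RHS]/(algHom_comp (comp_polyJ (e (fj_var k x0))) to_poly f).
apply: freeJordan_hom_ext => x; rewrite (X1 x) /= fj_eval_class /=.
by rewrite comp_polyX.
Qed.

(** The polynomials of [h] and [g] compose to ['X]. Degrees multiply under composition, so that of
    [h] has degree one, and it has no constant term. *)
Lemma split_endo_linear (g h : algHom (freeJordan k X : linAlgType k) (freeJordan k X)) :
  cancel h g -> exists a, h (fj_var k x0) = a *: fj_var k x0.
Proof.
move=> hK; set p : {poly k} := to_poly (h (fj_var k x0)).
have : p \Po (to_poly (g (fj_var k x0)) : {poly k}) = 'X.
  rewrite -(to_poly_comp (algHom_comp to_poly g)) /= hK.
  by rewrite fj_eval_class.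
move/(congr1 (fun q : {poly k} => (size q).-1)); rewrite size_comp_poly size_polyX.
move/eqP; rewrite muln_eq1 => /andP[/eqP sp _].
exists p`_1; apply: to_poly_inj; rewrite algHomZ [to_poly (fj_var _ _)]fj_eval_class -/p.
apply/polyP => -[|[|i]]; rewrite coefZ coefX /= ?mulr1 ?mulr0 //.
  exact: to_poly_coef0.
by apply: nth_default; case: (size p) sp => [|[|[|]]].
Qed.

Lemma retract_single (Y : eqType)
    (i : algHom (freeJordan k Y : linAlgType k) (freeJordan k X))
    (r : algHom (freeJordan k X : linAlgType k) (freeJordan k Y)) :
  cancel i r -> forall y y' : Y, y = y'.
Proof.
move=> iK y y'; apply/eqP/negP => /negP yy'.
pose e z : algHom (freeJordan k Y : linAlgType k) (polyJ k) :=
  fj_lift (fun u => (if u == z then 'X else 0 : {poly k}) : polyJ k).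
have eE z u : (to_poly (i (fj_var k u)) : {poly k}) \Po (e z (r (fj_var k x0)))
    = if u == z then 'X else 0.
  by rewrite -(to_poly_comp (algHom_comp (e z) r)) /= iK fj_eval_class.
(* At [z = y] the inner polynomial has degree one, and composing the polynomial of [y'] with it
   gives 0, so the latter is 0. Then [z = y'] yields ['X = 0]. *)
have := eE y y; rewrite eqxx.
move/(congr1 (fun q : {poly k} => (size q).-1)); rewrite size_comp_poly size_polyX.
move/eqP; rewrite muln_eq1 => /andP[_ /eqP sg].
have := eE y y'; rewrite eq_sym (negPf yy') => /eqP; rewrite comp_poly_eq0; last first.
  by move: sg; case: (size _) => [|[|]].
move=> /eqP q0; have := eE y' y'; rewrite eqxx q0 comp_poly0 => /eqP.
by rewrite eq_sym polyX_eq0.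
Qed.

End SingleGenerator.

Lemma char0_exp2_inj (k : fieldType) : [pchar k] =i pred0 ->
  forall i j : nat, 2%:R ^+ i = 2%:R ^+ j :> k -> i = j.
Proof.
move=> /pcharf0P k0.
have le i j : (i <= j)%N -> 2%:R ^+ i = 2%:R ^+ j :> k -> i = j.
  move=> ij /eqP; rewrite -!natrX eq_sym -subr_eq0 -natrB ?leq_exp2l // k0 subn_eq0.
  by rewrite leq_exp2l // => ji; apply/eqP; rewrite eqn_leq ij.
move=> i j e; case: (leqP i j) => [/le|/ltnW/le]; first exact.
by move=> H; rewrite H.
Qed.

(** * Automorphisms of a category are full and faithful *)

Section CatAutTheory.
Variable C : category.

(** Equal functors have hom-sets of different types; with [F] a variable the equation can be
    substituted. *)
Lemma fmap_eq_id_bij (F : functor C C) : F = functor_id C ->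
  forall A B : C, bijective (@fmap _ _ F A B).
Proof. by move=> -> A B; exists id. Qed.

Variable F : cat_aut C.

Lemma cat_aut_faithful (A B : C) : injective (@fmap _ _ F A B).
Proof.
move=> f g fg; apply: (bij_inj (fmap_eq_id_bij (ca_funK F) A B)) => /=.
by rewrite /functor_comp_fmap fg.
Qed.

Lemma cat_aut_full (A B : C) (h : cat_hom (F A) (F B)) : exists f, fmap F f = h.
Proof.
have [g gK Kg] := fmap_eq_id_bij (ca_funK F) A B.
(* Its image under [F] and [h] agree after the inverse functor, which is faithful. *)
exists (g (fmap (ca_inv F) h)).
have inv_inj : injective (@fmap _ _ (ca_inv F) (F A) (F B)).
  move=> f f' ff'; apply: (bij_inj (fmap_eq_id_bij (ca_invK F) _ _)) => /=.
  by rewrite /functor_comp_fmap ff'.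
exact: inv_inj (Kg _).
Qed.

Lemma cat_aut_obj_surj (B : C) : exists A, F A = B.
Proof. by exists (ca_inv F B); exact: (congr1 (fun G : functor C C => G B) (ca_invK F)). Qed.
End CatAutTheory.

Lemma fj_var_neq0 (k : fieldType) (X : Type) (x : X) : fj_var k x != 0.
Proof.
apply/eqP => /(congr1 (fj_lift (fun _ => ('X : {poly k}) : polyJ k))).
by rewrite algHom0 [LHS]fj_eval_class => /eqP; rewrite polyX_eq0.
Qed.

(** * Linear and bilinear elements in two variables *)

Section MultilinearElements.
Variables (k : fieldType) (X : eqType) (u v : X).
Hypothesis t_inj : forall i j : nat, 2%:R ^+ i = 2%:R ^+ j :> k -> i = j.
Hypothesis uv : u != v.
Hypothesis X2 : forall z, z = u \/ z = v.

Definition scale_vars (w : X -> nat) :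
    algHom (freeJordan k X : linAlgType k) (freeJordan k X) :=
  fj_lift (fun z => 2%:R ^+ w z *: fj_var k z).

Lemma degree1P (m : monomial X) : degree m = 1%N -> exists z, m = MVar z.
Proof.
case: m => [z|m1 m2] d; first by exists z.
have := leq_add (degree_gt0 m1) (degree_gt0 m2).
by rewrite -[(degree m1 + _)%N]/(degree (MMul m1 m2)) d.
Qed.

Lemma scale_vars_weight w (f : freeJordan k X) l e :
  f = msum (@fj_var k X) l -> scale_vars w f = 2%:R ^+ e *: f ->
  f = msum (@fj_var k X) [seq p <- l | mon_weight w p.2 == e].
Proof.
move=> -> E; apply: (msum_weight t_inj) E => z.
by rewrite [LHS]fj_lift_var.
Qed.

Lemma linear_element (f : freeJordan k X) :
  scale_vars (fun=> 1%N) f = 2%:R *: f ->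
  exists a b, f = a *: fj_var k u + b *: fj_var k v.
Proof.
move=> f2; have [l fl] := freeJordan_msum f; rewrite -[2%:R]expr1 in f2.
rewrite (scale_vars_weight fl f2) /msum big_filter; elim: l {f2 fl} => [|p l [a [b IH]]].
  by exists 0, 0; rewrite big_nil !scale0r addr0.
rewrite big_cons; case: eqP => [/degree1P [z ->]|_]; last by exists a, b.
rewrite {}IH /=; case: (X2 z) => ->.
  by exists (p.1 + a), b; rewrite scalerDl addrA.
by exists a, (p.1 + b); rewrite scalerDl addrCA.
Qed.

(** Doubling each variable separately leaves the monomials of degree one in [u] and in [v];
    commutativity identifies the two of them. *)
Lemma bilinear_element (f : freeJordan k X) :
  scale_vars (fun z => z == u) f = 2%:R *: f ->
  scale_vars (fun z => z == v) f = 2%:R *: f ->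
  exists c, f = c *: (fj_var k u * fj_var k v)%g.
Proof.
rewrite -[2%:R]expr1 => fu fv; have [l fl] := freeJordan_msum f.
have {}fl := scale_vars_weight fl fu; have {}fl := scale_vars_weight fl fv.
rewrite {}fl /msum big_filter big_filter_cond; elim: l {fu fv} => [|p l [c IH]].
  by exists 0; rewrite big_nil scale0r.
rewrite big_cons; case: ifP => [/andP[/eqP pu /eqP pv]|_]; last by exists c.
rewrite {}IH; exists (p.1 + c); rewrite scalerDl; congr (_ *: _ + _).
have mD (m : monomial X) : degree m =
    (mon_weight (fun z => z == u) m + mon_weight (fun z => z == v) m)%N.
  elim: m => [z|m1 IH1 m2 IH2] /=.
    by case: (X2 z) => ->; rewrite eqxx ?(eq_sym v) (negPf uv).
  by rewrite addnACA -IH1 -IH2.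
have := mD p.2; rewrite pu pv; case: p.2 pu pv => [z|m1 m2] //= pu pv.
have := degree_gt0 m1; have := degree_gt0 m2.
move=> d2 d1 dM; have d12 : (degree m1 + degree m2)%N = 2%N := dM.
have /degree1P[z1 e1] : degree m1 = 1%N.
  by apply/eqP; rewrite eqn_leq d1 andbT -(leq_add2r (degree m2)) d12 add1n ltnS.
have /degree1P[z2 e2] : degree m2 = 1%N.
  by apply/eqP; rewrite eqn_leq d2 andbT -(leq_add2l (degree m1)) d12 addn1 ltnS.
subst m1 m2; move: pu pv => /=.
case: (X2 z1) => ->; case: (X2 z2) => ->; rewrite ?eqxx ?(eq_sym v) ?(negPf uv) //.
by move=> _ _; exact: jordan_mulC.
Qed.
End MultilinearElements.

(** The maps [s] are in general not morphisms of the category; for [phi] the identity they are, and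
    form a natural isomorphism from the identity functor. *)
Definition semilinear_natural (k : fieldType) (F : functor (freeJordanCat k) (freeJordanCat k))
    (phi : k -> k) : Prop :=
  exists s : forall X : {fset nat}, freeJordanAlg k X -> freeJordanAlg k (F X),
  [/\ forall X, bijective (s X),
      forall X a b, s X (a + b) = s X a + s X b,
      forall X a b, s X (a * b)%g = (s X a * s X b)%g,
      forall X c a, s X (c *: a) = phi c *: s X a
    & forall (X Y : {fset nat}) (f : freeJordanHom k X Y) a,
        (fmap F f : freeJordanHom k (F X) (F Y)) (s X a) = s Y (f a)].

Lemma inj_surj_bij (A B : Type) (f : A -> B) :
  injective f -> (forall b, exists a, f a = b) -> bijective f.
Proof.
move=> fI fS; pose g b := projT1 (cid (fS b)).
have fg b : f (g b) = b := projT2 (cid (fS b)).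
by exists g => // a; apply: fI; rewrite fg.
Qed.

(** * An automorphism on the one-generated algebra *)

Section Automorphism.
Variables (k : fieldType) (hk : [pchar k] =i pred0) (F : cat_aut (freeJordanCat k)).
Local Notation Fr X := (freeJordanAlg k X).
Local Notation hom X Y := (freeJordanHom k X Y).

Let t_inj := char0_exp2_inj hk.

Lemma char0_two_neq0 : (2%:R : k) != 0.
Proof. by move/pcharf0P: hk => ->. Qed.

Definition gens1 : {fset nat} := [fset 0%N]%fset.
Definition gens1_pt : gens1 := [` fset11 0%N]%fset.

Lemma one_single (z : gens1) : z = gens1_pt.
Proof. by apply: val_inj; have /fset1P := valP z. Qed.

Definition pt (X : {fset nat}) (a : Fr X) : hom gens1 X := fj_lift (fun=> a).

Lemma ptE X (a : Fr X) : pt a (fj_var k gens1_pt) = a.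
Proof. exact: fj_lift_var. Qed.

Lemma pt_var X (f : hom gens1 X) : pt (f (fj_var k gens1_pt)) = f.
Proof.
by apply: algHom_eq; apply: freeJordan_hom_ext => z; rewrite (one_single z) ptE.
Qed.

Lemma comp_pt X Y (f : hom X Y) (a : Fr X) : algHom_comp f (pt a) = pt (f a).
Proof.
apply: algHom_eq; apply: freeJordan_hom_ext => z.
by rewrite (one_single z) ptE /= [X in f X]ptE.
Qed.

Lemma empty_hom_eq (X Y : {fset nat}) (f g : hom X Y) : (X -> False) -> f = g.
Proof. by move=> X0; apply: algHom_eq; apply: freeJordan_hom_ext => x; case: (X0 x). Qed.

Lemma one_hom_neq : algHom_id (Fr gens1) <> pt 0.
Proof.
move/(congr1 (fun f : hom gens1 gens1 => f (fj_var k gens1_pt))); rewrite ptE /= => /eqP.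
exact/negP/fj_var_neq0.
Qed.

(** Write [gens1] as [F Z]. Neither [Z] nor [F gens1] is empty, as the algebra without generators
    has a single endomorphism. So [gens1] is a retract of [Z], and [F gens1] one of [F Z], which has
    one generator. *)
Lemma image_one_single : exists y : F gens1, forall z, z = y.
Proof.
have [Z eZ] := cat_aut_obj_surj F gens1.
have [x1 Z1] : exists x1 : F Z, forall x, x = x1.
  by rewrite eZ; exists gens1_pt; exact: one_single.
have neZ : exists f g : cat_hom (F Z) (F Z), f <> g.
  by rewrite eZ; exists (algHom_id (Fr gens1)), (pt 0); exact: one_hom_neq.
have [z _] : exists z : Z, True.
  apply: contrapT => Z0; have [f [g]] := neZ; apply.
  have [f' <-] := cat_aut_full f; have [g' <-] := cat_aut_full g.
  by congr fmap; apply: empty_hom_eq => x; apply: Z0; exists x.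
have [y _] : exists y : F gens1, True.
  apply: contrapT => F0; apply: one_hom_neq; apply: (@cat_aut_faithful _ F gens1 gens1).
  by apply: empty_hom_eq => x; apply: F0; exists x.
exists y => y'.
pose r : hom Z gens1 := fj_lift (fun=> fj_var k gens1_pt).
have rK : algHom_comp r (pt (fj_var k z)) = algHom_id (Fr gens1).
  by rewrite comp_pt [r _]fj_lift_var -[RHS]pt_var.
have := congr1 (@fmap _ _ F gens1 gens1) rK.
rewrite (@fmap_comp _ _ F gens1 Z gens1 r (pt (fj_var k z))) (fmap_id F gens1) => FrK.
apply: (@retract_single k (F Z) x1 Z1 (F gens1)
   (fmap F (pt (fj_var k z))) (@fmap _ _ F Z gens1 r)) => a.
by have := congr1 (fun f : hom (F gens1) (F gens1) => f a) FrK.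
Qed.

(** * The induced bijections on elements and scalars *)

Section Transport.
Variable y : F gens1.
Hypothesis y1 : forall z, z = y.

(* Hom([gens1], -) is the underlying-set functor, so [F] acts on elements. *)
Definition transp (X : {fset nat}) (a : Fr X) : Fr (F X) :=
  (fmap F (pt a) : hom (F gens1) (F X)) (fj_var k y).

Lemma transp_nat (X Y : {fset nat}) (f : hom X Y) a :
  (fmap F f : hom (F X) (F Y)) (transp a) = transp (f a).
Proof.
rewrite /transp -comp_pt.
by rewrite (@fmap_comp _ _ F gens1 X Y f (pt a)).
Qed.

Lemma transp_inj X : injective (@transp X).
Proof.
move=> a b ab; rewrite -(ptE a) -(ptE b).
have -> // : pt a = pt b.
apply: (@cat_aut_faithful _ F gens1 X); apply: algHom_eq.
by apply: freeJordan_hom_ext => z; rewrite (y1 z).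
Qed.

Lemma transp_surj X (b : Fr (F X)) : exists a, transp a = b.
Proof.
have [h hE] := @cat_aut_full _ F gens1 X (fj_lift (fun=> b) : hom (F gens1) (F X)).
exists (h (fj_var k gens1_pt)); rewrite /transp pt_var hE.
exact: fj_lift_var.
Qed.

(** The algebra without generators is 0, so surjectivity of [transp] gives the claim there;
    naturality carries it to [X]. *)
Lemma transp0 X : transp (0 : Fr X) = 0.
Proof.
have e0 (c : Fr fset0) : c = 0.
  have [l ->] := freeJordan_msum c; rewrite /msum; elim: l => [|[p m] l IH].
    by rewrite big_nil.
  by have [] : False by elim: m => // -[x]; rewrite in_fset0.
have z0 : transp (0 : Fr fset0) = 0.
  by have [a <-] := transp_surj (0 : Fr (F fset0)); rewrite (e0 a).
pose f : hom fset0 X := fj_lift (fun=> 0).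
by rewrite -(algHom0 f) -transp_nat z0 algHom0.
Qed.

Lemma transp_var_one : transp (fj_var k gens1_pt) = fj_var k y.
Proof.
rewrite /transp (pt_var (algHom_id (Fr gens1))).
by have /(congr1 (fun f : hom (F gens1) (F gens1) => f (fj_var k y))) := fmap_id F gens1.
Qed.

Lemma scale_pt X (c : k) (a : Fr X) :
  c *: a = pt a (c *: fj_var k gens1_pt).
Proof. by rewrite algHomZ ptE. Qed.

(** For [c] nonzero the substitution [x |-> c x] is invertible, hence so is its image under [F], and
    [split_endo_linear] applies. *)
Lemma transp_scale_one c : exists d, transp (c *: fj_var k gens1_pt) = d *: fj_var k y.
Proof.
have [->|c0] := eqVneq c 0; first by exists 0; rewrite !scale0r transp0.
pose h := pt (c *: fj_var k gens1_pt); pose g := pt (c^-1 *: fj_var k gens1_pt).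
have gh : algHom_comp g h = algHom_id (Fr gens1).
  by rewrite comp_pt -[RHS]pt_var algHomZ ptE scalerA mulfV // scale1r.
have := congr1 (@fmap _ _ F gens1 gens1) gh.
rewrite (@fmap_comp _ _ F gens1 gens1 gens1 g h) (fmap_id F gens1) => FghK.
apply: (@split_endo_linear k (F gens1) y char0_two_neq0 y1 (fmap F g) (fmap F h)) => a.
by have := congr1 (fun f : hom (F gens1) (F gens1) => f a) FghK.
Qed.

Lemma transp_scale_one_surj d : exists c, transp (c *: fj_var k gens1_pt) = d *: fj_var k y.
Proof.
have [->|d0] := eqVneq d 0; first by exists 0; rewrite !scale0r transp0.
pose q e : hom (F gens1) (F gens1) := fj_lift (fun=> e *: fj_var k y).
have qE e : q e (fj_var k y) = e *: fj_var k y by rewrite [LHS]fj_lift_var.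
have [h hE] := @cat_aut_full _ F gens1 gens1 (q d).
have [g gE] := @cat_aut_full _ F gens1 gens1 (q d^-1).
have gh : algHom_comp g h = algHom_id (Fr gens1).
  apply: (@cat_aut_faithful _ F gens1 gens1).
  rewrite (@fmap_comp _ _ F gens1 gens1 gens1 g h) (fmap_id F gens1) hE gE.
  apply: algHom_eq; apply: freeJordan_hom_ext => z; rewrite (y1 z).
  by rewrite -[LHS]/(q d^-1 (q d (fj_var k y))) qE algHomZ qE scalerA mulfV ?scale1r.
have [c hc] : exists c, h (fj_var k gens1_pt) = c *: fj_var k gens1_pt.
  apply: (@split_endo_linear k gens1 gens1_pt char0_two_neq0 one_single g h) => a.
  by have := congr1 (fun f : hom gens1 gens1 => f a) gh.
by exists c; rewrite /transp -hc pt_var hE qE.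
Qed.

Definition scalar_map (c : k) : k := projT1 (cid (transp_scale_one c)).

(** Since [c *: a] comes from [c x] by substituting [a] for [x], the scalar found on the generator
    serves everywhere. *)
Lemma transpZ X c (a : Fr X) : transp (c *: a) = scalar_map c *: transp a.
Proof.
have E : transp (c *: fj_var k gens1_pt) = scalar_map c *: fj_var k y
  := projT2 (cid (transp_scale_one c)).
by rewrite (scale_pt c a) -transp_nat E algHomZ -transp_var_one transp_nat ptE.
Qed.

Lemma transp_one_neq0 : transp (fj_var k gens1_pt) != 0.
Proof. by rewrite transp_var_one fj_var_neq0. Qed.

Lemma scalar_mapP c d :
  transp (c *: fj_var k gens1_pt) = d *: transp (fj_var k gens1_pt) -> scalar_map c = d.
Proof.
rewrite transpZ => /eqP; rewrite -subr_eq0 -scalerBl scaler_eq0.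
by rewrite (negPf transp_one_neq0) orbF subr_eq0 => /eqP.
Qed.

Definition gens2 : {fset nat} := [fset 0%N; 1%N]%fset.
Definition var0 : gens2 := [` fset21 0%N 1%N]%fset.
Definition var1 : gens2 := [` fset22 0%N 1%N]%fset.

Lemma two_vars (z : gens2) : z = var0 \/ z = var1.
Proof. by have /fset2P[] := valP z => e; [left|right]; apply: val_inj. Qed.

Lemma var01 : var0 != var1. Proof. by []. Qed.

Definition pair_hom X (a b : Fr X) : hom gens2 X :=
  fj_lift (fun z : gens2 => if z == var0 then a else b).

Lemma pair_hom0 X (a b : Fr X) : pair_hom a b (fj_var k var0) = a.
Proof. exact: fj_lift_var. Qed.

Lemma pair_hom1 X (a b : Fr X) : pair_hom a b (fj_var k var1) = b.
Proof. exact: fj_lift_var. Qed.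

Lemma scale_varsE (w : gens2 -> nat) z :
  scale_vars k w (fj_var k z) = 2%:R ^+ w z *: fj_var k z.
Proof. exact: fj_lift_var. Qed.

Lemma transpD X (a b : Fr X) : transp (a + b) = transp a + transp b.
Proof.
have [w wE] := transp_surj (transp (fj_var k var0) + transp (fj_var k var1)).
have add (Y : {fset nat}) (f : hom gens2 Y) (c d : Fr Y) :
  c = f (fj_var k var0) -> d = f (fj_var k var1) -> transp c + transp d = transp (f w).
  by move=> -> ->; rewrite -!transp_nat wE algHomD.
have /(linear_element t_inj two_vars) [c [d wcd]] :
    scale_vars k (fun=> 1%N) w = 2%:R *: w.
  (* The scalar attached to 2 is not yet known to be 2, but it factors out of both summands. *)
  apply: transp_inj; rewrite transpZ wE scalerDr -!transpZ.
  by rewrite -(add gens2 _ (2%:R *: fj_var k var0) (2%:R *: fj_var k var1)) ?scale_varsE ?expr1.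
have cd Y (a' b' : Fr Y) : transp a' + transp b' = transp (c *: a' + d *: b').
  rewrite (add _ (pair_hom a' b')) ?pair_hom0 ?pair_hom1 // wcd.
  by rewrite algHomD !algHomZ pair_hom0 pair_hom1.
(* Setting the other variable to 0 isolates one coefficient. *)
have c1 : c *: a = a.
  by apply: transp_inj; have := cd _ a 0; rewrite transp0 scaler0 !addr0.
have d1 : d *: b = b.
  by apply: transp_inj; have := cd _ 0 b; rewrite transp0 scaler0 !add0r.
by rewrite cd c1 d1.
Qed.

Lemma transpM : exists c, c != 0 /\
  forall X (a b : Fr X), (transp a * transp b)%g = c *: transp (a * b)%g.
Proof.
have [w wE] := transp_surj (transp (fj_var k var0) * transp (fj_var k var1))%g.
have mul (Y : {fset nat}) (f : hom gens2 Y) (c d : Fr Y) :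
  c = f (fj_var k var0) -> d = f (fj_var k var1) ->
  (transp c * transp d)%g = transp (f w).
  by move=> -> ->; rewrite -!transp_nat wE algHom_mul.
have /(bilinear_element t_inj var01 two_vars) : scale_vars k (fun z => z == var0) w = 2%:R *: w.
  apply: transp_inj; rewrite transpZ wE -la_scaleAl -transpZ.
  by rewrite -(mul gens2 _ (2%:R *: fj_var k var0) (fj_var k var1)) ?scale_varsE ?expr1 ?scale1r.
case=> [|c wc].
  apply: transp_inj; rewrite transpZ wE -la_scaleAr -transpZ.
  by rewrite -(mul gens2 _ (fj_var k var0) (2%:R *: fj_var k var1)) ?scale_varsE ?expr1 ?scale1r.
have cM X (a b : Fr X) : (transp a * transp b)%g = scalar_map c *: transp (a * b)%g.
  rewrite -transpZ (mul _ (pair_hom a b)) ?pair_hom0 ?pair_hom1 // wc.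
  by rewrite algHomZ algHom_mul pair_hom0 pair_hom1.
(* A zero constant would make the square of [y] vanish, while [to_poly] maps it to the square of
   ['X]. *)
exists (scalar_map c); split=> //; apply/eqP => c0.
have := cM gens1 (fj_var k gens1_pt) (fj_var k gens1_pt).
rewrite c0 scale0r transp_var_one => /(congr1 (@to_poly k (F gens1))).
have yX : @to_poly k (F gens1) (fj_var k y) = 'X by exact: fj_lift_var.
rewrite algHom0 algHom_mul yX polyJ_mulE => /eqP.
by rewrite mulf_eq0 orbb polyX_eq0.
Qed.

Lemma scalar_mapM c d : scalar_map (c * d) = scalar_map c * scalar_map d.
Proof. by apply: scalar_mapP; rewrite -scalerA !transpZ scalerA. Qed.

Lemma scalar_mapD c d : scalar_map (c + d) = scalar_map c + scalar_map d.
Proof. by apply: scalar_mapP; rewrite scalerDl transpD !transpZ scalerDl. Qed.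

Lemma scalar_map1 : scalar_map 1 = 1.
Proof. by apply: scalar_mapP; rewrite !scale1r. Qed.

Lemma scalar_map_inj : injective scalar_map.
Proof.
move=> c d cd; have : transp (c *: fj_var k gens1_pt) = transp (d *: fj_var k gens1_pt).
  by rewrite !transpZ cd.
move=> /transp_inj /eqP; rewrite -subr_eq0 -scalerBl scaler_eq0 subr_eq0.
by rewrite (negPf (fj_var_neq0 _ _)) orbF => /eqP.
Qed.

Lemma scalar_map_surj d : exists c, scalar_map c = d.
Proof.
have [c cE] := transp_scale_one_surj d; exists c; apply: scalar_mapP.
by rewrite cE transp_var_one.
Qed.

End Transport.
End Automorphism.

(** * The field automorphism attached to [F] *)

Lemma fieldAut_of_bij (k : fieldType) (f : k -> k) :
  {morph f : x y / x + y} -> {morph f : x y / x * y} -> f 1 = 1 -> bijective f ->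
  exists phi : fieldAut k, phi =1 f.
Proof.
move=> fD fM f1 [g fK gK].
have f0 : f 0 = 0 by apply: (addrI (f 0)); rewrite -fD !addr0.
have gD : {morph g : x y / x + y} by move=> x y; rewrite -{1}(gK x) -{1}(gK y) -fD fK.
have gM : {morph g : x y / x * y} by move=> x y; rewrite -{1}(gK x) -{1}(gK y) -fM fK.
have g1 : g 1 = 1 by rewrite -f1 fK.
have g0 : g 0 = 0 by rewrite -f0 fK.
pose fn := Algebra.isNmodMorphism.Build k k f (conj f0 fD).
pose fm := GRing.isMonoidMorphism.Build k k f (conj f1 fM).
pose gn := Algebra.isNmodMorphism.Build k k g (conj g0 gD).
pose gm := GRing.isMonoidMorphism.Build k k g (conj g1 gM).
pose fr : {rmorphism k -> k} := HB.pack f fn fm.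
pose gr : {rmorphism k -> k} := HB.pack g gn gm.
by exists (@FieldAut k fr gr fK gK).
Qed.

Lemma cat_aut_semilinear (k : fieldType) (hk : [pchar k] =i pred0)
    (F : cat_aut (freeJordanCat k)) :
  exists phi : fieldAut k, semilinear_natural F phi.
Proof.
have [y y1] := image_one_single F.
have smb : bijective (scalar_map hk y1).
  by apply: inj_surj_bij; [exact: scalar_map_inj | exact: scalar_map_surj].
have [phi phiE] := fieldAut_of_bij (scalar_mapD hk y1) (scalar_mapM hk y1)
  (scalar_map1 hk y1) smb.
have [c [c0 cM]] := transpM hk y1.
(* With this factor, products pick up [c^-1 * c^-1 * c = c^-1], so the maps are multiplicative. *)
exists phi, (fun X a => c^-1 *: transp y a); split=> [X|X a b|X a b|X d a|X Y f a].
- apply: inj_surj_bij => [a b /(scalerI (invr_neq0 c0))|b]; first exact: transp_inj.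
  have [a aE] := transp_surj y (c *: b); exists a.
  by rewrite aE scalerA mulVf // scale1r.
- by rewrite (transpD hk y1) scalerDr.
- by rewrite la_scaleAl la_scaleAr cM !scalerA -mulrA mulVf // mulr1.
- by rewrite (transpZ hk y1) phiE !scalerA mulrC.
- by rewrite algHomZ transp_nat.
Qed.

(** * Uniqueness, composition and inner automorphisms *)

Section SemilinearNatural.
Variable k : fieldType.
Local Notation C := (freeJordanCat k).
Local Notation Fr X := (freeJordanAlg k X).
Local Notation hom X Y := (freeJordanHom k X Y).
Implicit Types F G : functor C C.

(** If [s a = s' x], then [x |-> a] has a left inverse, so [a] is a multiple of [x]. Hence
    [x |-> mu x] multiplies [a] by [mu], and its image under [F] multiplies [s' x] by both [phi mu]
    and [psi mu]. *)
Lemma semilinear_natural_uniq F (phi psi : fieldAut k) : (2%:R : k) != 0 ->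
  semilinear_natural F phi -> semilinear_natural F psi -> phi = psi.
Proof.
move=> k2 [s [sb sD _ sZ sN]] [s' [s'b s'D _ s'Z s'N]].
pose x : Fr gens1 := fj_var k gens1_pt.
have [r rK Kr] := sb gens1; have [r' r'K Kr'] := s'b gens1.
pose a := r (s' _ x); have sa : s _ a = s' _ x by exact: Kr.
pose b := r' (s _ x); have sb' : s' _ b = s _ x by exact: Kr'.
have ba : pt b a = x.
  by apply: (bij_inj (sb gens1)); rewrite -sN sa s'N ptE.
have [c ac] : exists c, pt a x = c *: x.
  apply: (@split_endo_linear k gens1 gens1_pt k2 one_single (pt b) (pt a)) => z.
  rewrite -[LHS]/(algHom_comp (pt b) (pt a) z) comp_pt ba.
  by rewrite /x (pt_var (algHom_id (Fr gens1))).
rewrite ptE in ac.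
have s'x : s' _ x != 0.
  have s'0 : s' gens1 0 = 0 by apply: (addrI (s' gens1 0)); rewrite -s'D !addr0.
  by rewrite -s'0 (inj_eq (bij_inj (s'b gens1))) fj_var_neq0.
apply: fieldAut_eq => mu; apply/eqP; rewrite -subr_eq0.
have : (phi mu - psi mu) *: s' _ x = 0.
  apply/eqP; rewrite scalerBl subr_eq0 -s'Z -{1}sa -sZ.
  have <- : pt (mu *: x) x = mu *: x by rewrite ptE.
  by rewrite -s'N -sa sN ac algHomZ ptE scalerA mulrC -scalerA.
by move/eqP; rewrite scaler_eq0 (negPf s'x) orbF.
Qed.

Lemma semilinear_natural_comp F G (phi psi : k -> k) :
  semilinear_natural F phi -> semilinear_natural G psi ->
  semilinear_natural (functor_comp F G) (phi \o psi).
Proof.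
move=> [s [sb sD sM sZ sN]] [t [tb tD tM tZ tN]].
exists (fun X a => s (G X) (t X a)); split=> [X|X a b|X a b|X c a|X Y f a].
- exact: bij_comp (sb (G X)) (tb X).
- by rewrite tD sD.
- by rewrite tM sM.
- by rewrite tZ sZ.
- by rewrite -tN -sN.
Qed.

Lemma inner_semilinear_natural F :
  nat_iso (functor_id C) F -> semilinear_natural F (fieldAut_one k).
Proof.
move=> [s [si sN]]; exists (fun X => algHom_fun (s X)).
split=> [X|X a b|X a b|X c a|X Y f a].
- have [g [gs sg]] := si X; exists (algHom_fun g) => a.
    by have := congr1 (fun h : hom X X => h a) gs.
  by have := congr1 (fun h : hom (F X) (F X) => h a) sg.
- exact: algHomD.
- exact: algHom_mul.
- exact: algHomZ.
- by have := congr1 (fun h : hom X (F Y) => h a) (sN X Y f).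
Qed.

Lemma semilinear_natural_inner F :
  semilinear_natural F (fieldAut_one k) -> nat_iso (functor_id C) F.
Proof.
move=> [s [sb sD sM sZ sN]].
have sl X : linear (s X) by move=> c a b; rewrite sD sZ.
pose S X : hom X (F X) := AlgHom (sl X) (sM X).
exists S; split=> [X|X Y f]; last by apply: algHom_eq => a; exact: sN.
have [r rK Kr] := sb X.
have rl : linear r by move=> c a b; rewrite -{1}(Kr a) -{1}(Kr b) -sl rK.
have rM : {morph r : a b / (a * b)%g} by move=> a b; rewrite -{1}(Kr a) -{1}(Kr b) -sM rK.
by exists (AlgHom rl rM : hom (F X) X); split; apply: algHom_eq => a; [exact: rK|exact: Kr].
Qed.

(** * Realizing field automorphisms by twisting scalars *)

Section Twisting.

(** This applies [phi] to the coefficients and fixes the generators. *)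
Definition twist_map (phi : {rmorphism k -> k}) (X : {fset nat}) : Fr X -> Fr X :=
  @fj_lift k X (twist phi (Fr X)) (@fj_var k X).

Variables (phi : {rmorphism k -> k}) (X : {fset nat}).

Lemma twist_mapD a b : twist_map phi (a + b) = twist_map phi a + twist_map phi b :> Fr X.
Proof. exact: (algHomD (@fj_lift k X (twist phi (Fr X)) (@fj_var k X))). Qed.

Lemma twist_mapM (a b : Fr X) :
  twist_map phi (a * b)%g = (twist_map phi a * twist_map phi b)%g.
Proof. exact: (algHom_mul (@fj_lift k X (twist phi (Fr X)) (@fj_var k X))). Qed.

Lemma twist_mapZ c (a : Fr X) : twist_map phi (c *: a) = phi c *: twist_map phi a.
Proof. exact: (algHomZ (@fj_lift k X (twist phi (Fr X)) (@fj_var k X))). Qed.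

Lemma twist_map_var x : twist_map phi (fj_var k x) = fj_var k x :> Fr X.
Proof. exact: (@fj_lift_var k X (twist phi (Fr X))). Qed.

End Twisting.

(** The composite is linear, as the scalar maps cancel, and it fixes the generators. *)
Lemma twist_mapK (phi psi : {rmorphism k -> k}) X : cancel phi psi ->
  cancel (@twist_map phi X) (@twist_map psi X).
Proof.
move=> phiK a; pose h := @twist_map psi X \o @twist_map phi X.
have hl : linear h by move=> c b d; rewrite /h /= !(twist_mapD, twist_mapZ) phiK.
have hM : {morph h : b d / (b * d)%g} by move=> b d; rewrite /h /= !twist_mapM.
rewrite -[LHS]/((AlgHom hl hM : hom X X) a) -[RHS]/(algHom_id (Fr X) a).
by apply: freeJordan_hom_ext => x; rewrite /= /h /= !twist_map_var.
Qed.

Section TwistFunctor.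
Variables (phi psi : {rmorphism k -> k}).
Hypotheses (phiK : cancel phi psi) (psiK : cancel psi phi).

Section TwistHom.
Variables (X Y : {fset nat}) (f : hom X Y).
(** Conjugating by mutually inverse semilinear bijections makes the result linear again. *)
Definition twist_hom_fun a := @twist_map phi Y (f (@twist_map psi X a)).

Lemma twist_hom_linear : linear twist_hom_fun.
Proof.
move=> c a b.
by rewrite /twist_hom_fun !(twist_mapD, twist_mapZ, algHomD, algHomZ) psiK.
Qed.

Lemma twist_hom_mul : {morph twist_hom_fun : a b / (a * b)%g}.
Proof. by move=> a b; rewrite /twist_hom_fun !(twist_mapM, algHom_mul). Qed.

Definition twist_hom : hom X Y := AlgHom twist_hom_linear twist_hom_mul.
End TwistHom.

Lemma twist_hom_id (X : {fset nat}) : twist_hom (algHom_id (Fr X)) = algHom_id (Fr X).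
Proof. by apply: algHom_eq => a; exact: twist_mapK. Qed.

Lemma twist_hom_comp (X Y Z : {fset nat}) (g : hom Y Z) (f : hom X Y) :
  twist_hom (algHom_comp g f) = algHom_comp (twist_hom g) (twist_hom f).
Proof. by apply: algHom_eq => a; rewrite /= /twist_hom_fun /= twist_mapK. Qed.

Definition twist_functor : functor C C :=
  @Functor C C id twist_hom twist_hom_id twist_hom_comp.

End TwistFunctor.

Lemma functor_eq_id (D : category) (fm : forall A B : D, cat_hom A B -> cat_hom A B) e1 eM :
  (forall A B (f : cat_hom A B), fm A B f = f) ->
  @Functor D D id fm e1 eM = functor_id D.
Proof.
move=> fmE; have E : fm = fun _ _ => id.
  by apply: functional_extensionality_dep => A; apply: functional_extensionality_dep => B;
     apply: functional_extensionality_dep => f; exact: fmE.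
by subst fm; rewrite /functor_id; congr Functor; exact: Prop_irrelevance.
Qed.

Lemma twist_functorK (phi psi : {rmorphism k -> k}) (phiK : cancel phi psi)
    (psiK : cancel psi phi) :
  functor_comp (twist_functor psiK phiK) (twist_functor phiK psiK) = functor_id C.
Proof.
apply: functor_eq_id => A B f; apply: algHom_eq => a.
by rewrite /= /twist_hom_fun /= /twist_hom_fun !twist_mapK.
Qed.

Definition twist_aut (phi : fieldAut k) : cat_aut C :=
  CatAut (twist_functorK (fa_funK phi) (fa_invK phi))
         (twist_functorK (fa_invK phi) (fa_funK phi)).

Lemma twist_aut_semilinear (phi : fieldAut k) : semilinear_natural (twist_aut phi) phi.
Proof.
exists (@twist_map phi); split=> [X|X a b|X a b|X c a|X Y f a].
- by exists (@twist_map (fa_inv phi) X); apply: twist_mapK;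
    [exact: fa_funK | exact: fa_invK].
- exact: twist_mapD.
- exact: twist_mapM.
- exact: twist_mapZ.
- by rewrite /= /twist_hom_fun twist_mapK //; exact: fa_funK.
Qed.

End SemilinearNatural.

(** * The isomorphism of groups *)

Theorem theorem4p4 (k : fieldType) (hk : [pchar k]%R =i pred0) :
  group_isomorphic (quotientGroup (inner_auts (freeJordanCat k))) (fieldAut k).
Proof.
have k2 := char0_two_neq0 hk.
pose Q := quotientGroup (inner_auts (freeJordanCat k)).
have ex (q : Q) := cat_aut_semilinear hk (qg_repr q).
pose f (q : Q) : fieldAut k := projT1 (cid (ex q)).
have fP (q : Q) : semilinear_natural (qg_repr q : cat_aut (freeJordanCat k)) (f q)
  := projT2 (cid (ex q)).
(* The representative of the class differs from [F] by an inner factor, whose field automorphism is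
   1. *)
have fE (F : cat_aut (freeJordanCat k)) (phi : fieldAut k) :
    semilinear_natural F phi -> f (qg_class _ F) = phi.
  move=> Fphi; set q := qg_class _ F.
  have /qg_classP/inner_semilinear_natural i : qg_class (inner_auts _) (qg_repr q) = q.
    exact: qg_reprK.
  apply: semilinear_natural_uniq Fphi => //.
  have := semilinear_natural_comp (fP q) i.
  by rewrite -[functor_comp _ _]/(ca_fun (qg_repr q * (_ * F)))%g mulgA mulgV mul1g.
have fM : {morph f : x y / (x * y)%g}.
  elim/qg_class_ind => F; elim/qg_class_ind => G.
  have [phi Fphi] := cat_aut_semilinear hk F.
  have [psi Gpsi] := cat_aut_semilinear hk G.
  rewrite (fE _ _ Fphi) (fE _ _ Gpsi) [(_ * _)%g]qg_mul_class; apply: fE.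
  exact: semilinear_natural_comp Fphi Gpsi.
pose fm : {multiplicative Q -> fieldAut k} := HB.pack f (isMultiplicative.Build _ _ f fM).
exists fm; apply: inj_surj_bij => [|phi]; last first.
  by exists (qg_class _ (twist_aut phi)); apply: fE; exact: twist_aut_semilinear.
elim/qg_class_ind => F; elim/qg_class_ind => G.
have [phi Fphi] := cat_aut_semilinear hk F.
have [psi Gpsi] := cat_aut_semilinear hk G.
have [chi Fchi] := cat_aut_semilinear hk (F^-1)%g.
rewrite /= (fE _ _ Fphi) (fE _ _ Gpsi) => e; subst psi.
apply/qg_classP; apply: semilinear_natural_inner.
(* Both sides belong to the identity functor, the left one written as [F^-1] after [F]; uniqueness
   equates them. *)
suff <- : fieldAut_mul chi phi = fieldAut_one k by exact: semilinear_natural_comp Fchi Gpsi.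
apply: (semilinear_natural_uniq (F := functor_id (freeJordanCat k)) k2).
  by rewrite -(ca_funK F); exact: semilinear_natural_comp Fchi Fphi.
exact: inner_semilinear_natural (nat_iso_refl _).
Qed.
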